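(* Let $R>0$ and let $(\epsilon_n)_{n\ge 1}$ be a sequence in $(0,1)$ with $\lim_{n\to\infty}\epsilon_n=0$ such that, for every $r>0$, $1/\epsilon_n=o(e^{rn})$ as $n\to\infty$. Then $$\lim_{n\to\infty}-\frac{1}{n}\log \beta_n(\epsilon_n,R)=\xi(R).$$
   Context: $\mathbb{X},\mathbb{Y}$ are finite alphabets and $(X,Y)$ is a random pair with values in $\mathbb{X}\times\mathbb{Y}$ and joint law $P_{XY}$, with marginals $P_X,P_Y$. Put $Q_{XY}=P_X\cdot P_Y$ (product law). It is assumed throughout that $\mathcal{D}(P_{XY}\|Q_{XY})=I(X;Y)>0$. $P_{XY}^n$ and $Q_{XY}^n$ denote the $n$-fold i.i.d. product laws on $\mathbb{X}^n\times\mathbb{Y}^n$. The logarithm $\log$ and all information quantities (mutual information, divergence) are taken to base 2, consistently with rates in bits per sample. An encoder of length $n$ and rate $R$ is a map $f_n:\mathbb{X}^n\to\{1,\dots,2^{nR}\}$ (integers $i$ with $1\le i\le 2^{nR}$); a decoder (detector) is a map $\phi_n:\{1,\dots,2^{nR}\}\times\mathbb{Y}^n\to\{0,1\}$. Let $\mathcal{A}(f_n,\phi_n)=\{(x_1^n,y_1^n)\in\mathbb{X}^n\times\mathbb{Y}^n:\phi_n(f_n(x_1^n),y_1^n)=0\}$, and define the Type I and Type II error probabilities $$P_0(f_n,\phi_n)=P_{XY}^n(\mathcal{A}^c(f_n,\phi_n)),\qquad P_1(f_n,\phi_n)=Q_{XY}^n(\mathcal{A}(f_n,\phi_n)).$$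 For $\epsilon>0$, $$\beta_n(\epsilon,R)=\min_{(f_n,\phi_n)}\{P_1(f_n,\phi_n):P_0(f_n,\phi_n)\le\epsilon\},$$ the minimum being over all encoder-decoder pairs of length $n$ and rate $R$. The limit is $$\xi(R)=\max\{I(U;Y): U-X-Y \text{ is a Markov chain},\ I(U;X)\le R,\ |\mathbb{U}|\le|\mathbb{X}|+1\},$$ where $U$ ranges over random variables with values in a finite alphabet $\mathbb{U}$, jointly distributed with $(X,Y)\sim P_{XY}$, such that $U$ and $Y$ are conditionally independent given $X$. *)

(* Defs.v *)
From mathcomp Require Import all_boot all_order all_algebra.
From mathcomp Require Import all_classical all_reals all_analysis.
Import Order.TTheory GRing.Theory Num.Theory.
Import numFieldNormedType.Exports.

Set Implicit Arguments.
Unset Strict Implicit.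
Unset Printing Implicit Defensive.

Local Open Scope classical_set_scope.
Local Open Scope ring_scope.

Definition log2 (R : realType) (x : R) : R := ln x / ln 2.

Definition is_pmf (R : realType) (A : finType) (p : A -> R) : Prop :=
  (forall a, 0 <= p a) /\ \sum_a p a = 1.

Definition prob (R : realType) (A : finType) (p : A -> R) (E : {set A}) : R :=
  \sum_(a in E) p a.

Definition law (R : realType) (A B : finType) (p : A -> R) (f : A -> B) (b : B) : R :=
  prob p [set a | f a == b].

(* Since 0 * _ = 0, this is the usual finite value whenever p is absolutely
   continuous w.r.t. q; the value +oo of the other case is not represented, and
   does not arise for a joint law against the product of its marginals. *)
Definition divergence (R : realType) (A : finType) (p q : A -> R) : R :=
  \sum_a p a * log2 (p a / q a).

Definition product_law (R : realType) (A B : finType) (p : A * B -> R) (ab : A * B) : R :=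
  law p fst ab.1 * law p snd ab.2.

Definition mutual_info (R : realType) (A B : finType) (p : A * B -> R) : R :=
  divergence p (product_law p).

Definition iid (R : realType) (X Y : finType) (n : nat) (p : X * Y -> R)
    (s : {ffun 'I_n -> X} * {ffun 'I_n -> Y}) : R :=
  \prod_i p (s.1 i, s.2 i).

(* The message set {1, ..., 2^(n r)} (integers i with 1 <= i <= 2^(n r)) is
   represented by 'I_(nmsg n r), i.e. with messages numbered from 0. *)
Definition nmsg (R : realType) (n : nat) (r : R) : nat := Num.truncn (2 `^ (n%:R * r)).

Definition encoder (R : realType) (X : finType) (n : nat) (r : R) : finType :=
  {ffun {ffun 'I_n -> X} -> 'I_(nmsg n r)}.

(* A decision in {0, 1} is a boolean, false being 0. *)
Definition decoder (R : realType) (Y : finType) (n : nat) (r : R) : finType :=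
  {ffun 'I_(nmsg n r) * {ffun 'I_n -> Y} -> bool}.

Definition acceptance (R : realType) (X Y : finType) (n : nat) (r : R)
    (f : encoder X n r) (phi : decoder Y n r) :
    {set {ffun 'I_n -> X} * {ffun 'I_n -> Y}} :=
  [set s | phi (f s.1, s.2) == false].

Definition typeI (R : realType) (X Y : finType) (P : X * Y -> R) (n : nat) (r : R)
    (f : encoder X n r) (phi : decoder Y n r) : R :=
  prob (iid P) (~: acceptance f phi).

Definition typeII (R : realType) (X Y : finType) (P : X * Y -> R) (n : nat) (r : R)
    (f : encoder X n r) (phi : decoder Y n r) : R :=
  prob (iid (product_law P)) (acceptance f phi).

Definition typeII_values (R : realType) (X Y : finType) (P : X * Y -> R) (n : nat)
    (eps r : R) : set R :=
  [set typeII P c.1 c.2 | c in [set c : encoder X n r * decoder Y n r |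
                                 typeI P c.1 c.2 <= eps]].

(* A minimum over a finite nonempty set when 0 < eps and 0 <= r: see betaP. *)
Definition beta (R : realType) (X Y : finType) (P : X * Y -> R) (n : nat)
    (eps r : R) : R :=
  inf (typeII_values P n eps r).

Definition markov_chain (R : realType) (U X Y : finType) (T : U * X * Y -> R) : Prop :=
  let PX := law T (fun w => w.1.2) in
  let PUX := law T (fun w => w.1) in
  let PXY := law T (fun w => (w.1.2, w.2)) in
  forall u x y, PX x != 0 ->
    T (u, x, y) / PX x = (PUX (u, x) / PX x) * (PXY (x, y) / PX x).

Definition admissible (R : realType) (U X Y : finType) (P : X * Y -> R) (r : R)
    (T : U * X * Y -> R) : Prop :=
  [/\ is_pmf T,
      law T (fun w => (w.1.2, w.2)) =1 P,
      markov_chain T,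
      mutual_info (law T (fun w => w.1)) <= r &
      (#|U| <= #|X| + 1)%N].

(* U ranges over all finite alphabets, and (U, X, Y) over all joint laws T. *)
Definition xi_values (R : realType) (X Y : finType) (P : X * Y -> R) (r : R) : set R :=
  [set i | exists (U : finType) (T : U * X * Y -> R),
     admissible P r T /\ i = mutual_info (law T (fun w => (w.1.1, w.2)))].

(* A maximum when P is a pmf and 0 <= r: see xiP. *)
Definition xi (R : realType) (X Y : finType) (P : X * Y -> R) (r : R) : R :=
  sup (xi_values P r).

Lemma betaP (R : realType) (X Y : finType) (P : X * Y -> R) (n : nat) (eps r : R) :
  0 < eps -> 0 <= r ->
  typeII_values P n eps r (beta P n eps r) /\
  lbound (typeII_values P n eps r) (beta P n eps r).
Proof.
move=> eps0 r0.
have N0 : (0 < nmsg n r)%N.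
  rewrite /nmsg truncn_gt0 -[leLHS](powRr0 2).
  by rewrite ler_powR ?ler1n// mulr_ge0.
pose f0 : encoder X n r := [ffun _ => Ordinal N0].
pose phi0 : decoder Y n r := [ffun _ => false].
have adm0 : typeI P f0 phi0 <= eps.
  rewrite /typeI /prob big_pred0 ?ltW// => s.
  by rewrite !inE ffunE eqxx.
pose ok (c : encoder X n r * decoder Y n r) := typeI P c.1 c.2 <= eps.
pose val (c : encoder X n r * decoder Y n r) := typeII P c.1 c.2.
have okc0 : ok (f0, phi0) by [].
case: (@Order.TotalTheory.arg_minP _ R _ (f0, phi0) ok val okc0) => c okc minc.
suff -> : beta P n eps r = val c.
  by split; [exists c|move=> _ [d okd <-]; exact: minc].
apply/eqP; rewrite eq_le; apply/andP; split.
  apply: ge_inf; last by exists c.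
  by exists (val c) => _ [d okd <-]; exact: minc.
apply: lb_le_inf; first by exists (val c), c.
by move=> _ [d okd <-]; exact: minc.
Qed.

Section law_theory.
Variable R : realType.

Lemma lawE (A B : finType) (p : A -> R) (f : A -> B) b :
  law p f b = \sum_(a | f a == b) p a.
Proof. by apply: eq_bigl => a; rewrite inE. Qed.

Lemma law_sum (A B : finType) (p : A -> R) (f : A -> B) (G : B -> R) :
  \sum_b law p f b * G b = \sum_a p a * G (f a).
Proof.
under eq_bigr do rewrite lawE mulr_suml.
rewrite (exchange_big_dep xpredT)//=.
by apply: eq_bigr => a _; rewrite (big_pred1 (f a))// => b /=; exact: eq_sym.
Qed.

Lemma law_comp (A B C : finType) (p : A -> R) (f : A -> B) (h : B -> C) :
  law (law p f) h = law p (h \o f).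
Proof.
apply/funext => c; rewrite !lawE.
under eq_bigr do rewrite lawE.
rewrite (exchange_big_dep (fun a => h (f a) == c))/=; last first.
  by move=> b a hb /eqP ->.
apply: eq_bigr => a hc; rewrite (big_pred1 (f a))// => b /=.
by rewrite andbC eq_sym; case: eqVneq => // ->; rewrite hc.
Qed.

Lemma law_inj (A B : finType) (p : A -> R) (f : A -> B) a :
  injective f -> law p f (f a) = p a.
Proof.
by move=> fI; rewrite lawE (big_pred1 a)// => b; rewrite (inj_eq fI).
Qed.

Lemma law_ge0 (A B : finType) (p : A -> R) (f : A -> B) b :
  (forall a, 0 <= p a) -> 0 <= law p f b.
Proof. by move=> p0; apply: sumr_ge0. Qed.

Lemma law_pmf (A B : finType) (p : A -> R) (f : A -> B) :
  is_pmf p -> is_pmf (law p f).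
Proof.
case=> p0 p1; split=> [b|]; first exact: law_ge0.
by have := law_sum p f (fun=> 1); under eq_bigr do rewrite mulr1;
  under [RHS]eq_bigr do rewrite mulr1; rewrite p1.
Qed.

Lemma law_ge (A B : finType) (p : A -> R) (f : A -> B) a :
  (forall a, 0 <= p a) -> p a <= law p f (f a).
Proof.
by move=> p0; rewrite lawE (bigD1 a)//= lerDl; apply: sumr_ge0.
Qed.

Lemma mutual_info_inj (A A' B : finType) (q : A * B -> R) (g : A -> A') :
  injective g -> mutual_info (law q (fun w => (g w.1, w.2))) = mutual_info q.
Proof.
move=> gI; rewrite /mutual_info /divergence (law_sum q).
apply: eq_bigr => -[a b] _ /=.
have fI : injective (fun w : A * B => (g w.1, w.2)).
  by move=> [a1 b1] [a2 b2] [/gI -> ->].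
congr (_ * log2 (_ / _)); first exact: (law_inj q (a, b) fI).
rewrite /product_law/= !law_comp; congr (_ * _).
have -> : fst \o (fun w : A * B => (g w.1, w.2)) = g \o fst by [].
by rewrite -law_comp law_inj.
Qed.

Definition xlnx (x : R) := x * ln x.

Lemma continuous_xlnx : continuous xlnx.
Proof.
move=> x; have [x0|x0|->] := ltgtP x 0.
- have : \forall y \near x, 0 = xlnx y.
    near=> y; rewrite /xlnx ln0 ?mulr0// ltW//.
    by near: y; exact: lt_nbhsl.
  move/near_eq_cvg => h; apply: cvg_trans h _.
  by rewrite /xlnx ln0 ?mulr0 ?ltW//; exact: cvg_cst.
- by apply: continuousM; [exact: cvg_id|exact: continuous_ln].
- rewrite /continuous_at {2}/xlnx mul0r; apply/cvgrPdist_lt => e e0.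
  near=> y; rewrite sub0r normrN /xlnx.
  have [y0|y0] := leP y 0; first by rewrite ln0// mulr0 normr0.
  have y1 : y < 1 by near: y; exact: lt_nbhsl.
  have s0 : 0 < Num.sqrt y by rewrite sqrtr_gt0.
  have lny : `|ln y| <= 2 / Num.sqrt y.
    rewrite ler0_norm; last by rewrite ln_le0// ltW.
    have := ltW (@ln_sublinear R (Num.sqrt y)^-1 _).
    rewrite invr_gt0 => /(_ s0); rewrite lnV ?posrE//.
    have -> : ln y = 2 * ln (Num.sqrt y).
      by rewrite -{1}(sqr_sqrtr (ltW y0)) lnXn// mulr_natl.
    by rewrite -mulrN ler_pM2l.
  rewrite normrM (gtr0_norm y0).
  apply: (@le_lt_trans _ _ (y * (2 / Num.sqrt y))); first by rewrite ler_pM2l.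
  have -> : y * (2 / Num.sqrt y) = 2 * Num.sqrt y.
    rewrite -{1}(sqr_sqrtr (ltW y0)) expr2 mulrCA -mulrA divff ?mulr1//.
    by rewrite gt_eqF.
  rewrite mulrC -ltr_pdivlMr// -[ltRHS]gtr0_norm ?divr_gt0// -sqrtr_sqr.
  rewrite ltr_sqrt ?exprn_gt0 ?divr_gt0//.
  by near: y; apply: lt_nbhsl; rewrite exprn_gt0 ?divr_gt0.
Unshelve. all: by end_near. Qed.

Definition ent (A B : finType) (p : A -> R) (f : A -> B) :=
  \sum_b xlnx (law p f b).

Lemma mutual_info_ent (A B : finType) (q : A * B -> R) :
  (forall a, 0 <= q a) ->
  mutual_info q = (ent q id - ent q fst - ent q snd) / ln 2.
Proof.
move=> q0; rewrite /mutual_info /divergence /ent /xlnx.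
rewrite (law_sum q id) (law_sum q fst) (law_sum q snd) -!sumrB mulr_suml.
apply: eq_bigr => ab _; rewrite /log2 mulrA -!mulrBr; congr (_ / _).
have [->|qN0] := eqVneq (q ab) 0; first by rewrite !mul0r.
have qp : 0 < q ab by rewrite lt_neqAle eq_sym qN0 q0.
have l1 : 0 < law q fst ab.1 by apply: lt_le_trans qp (law_ge fst ab q0).
have l2 : 0 < law q snd ab.2 by apply: lt_le_trans qp (law_ge snd ab q0).
rewrite /product_law ln_div ?posrE ?mulr_gt0// lnM ?posrE// opprD addrA.
by rewrite (@law_inj _ _ q id)//.
Qed.

Lemma ent_law (A B C : finType) (p : A -> R) (f : A -> B) (h : B -> C) :
  ent (law p f) h = ent p (h \o f).
Proof. by rewrite /ent law_comp. Qed.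

End law_theory.

Lemma continuous_sumf (R : realType) (Z : topologicalType) (I : Type)
    (s : seq I) (Q : pred I) (F : I -> Z -> R) :
  (forall i, Q i -> continuous (F i)) ->
  continuous (fun T => \sum_(i <- s | Q i) F i T).
Proof.
move=> cF; elim: s => [|i s IH] T.
  rewrite (_ : (fun T => _) = cst 0); last first.
    by apply/funext => t; rewrite big_nil.
  exact: cst_continuous.
rewrite (_ : (fun T => _) =
    (fun T => (if Q i then F i T else 0) + \sum_(j <- s | Q j) F j T)); last first.
  by apply/funext => t; rewrite big_cons; case: ifP => // _; rewrite add0r.
apply: (@continuousD R R Z); last exact: IH.
by case: (Q i) (cF i) => [/(_ isT)|_] c; [exact: c|exact: cst_continuous].
Qed.

Section compactness.
Variables (R : realType) (A : finType).
Let Z := prod_topology (fun _ : A => R).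

Lemma continuous_coordf a : continuous (fun T : Z => T a).
Proof. exact: (@proj_continuous A (fun=> R) a). Qed.

Lemma continuous_law (B : finType) (f : A -> B) b :
  continuous (fun T : Z => law T f b).
Proof. by apply: continuous_sumf => a _; exact: continuous_coordf. Qed.

Lemma continuous_ent (B : finType) (f : A -> B) :
  continuous (fun T : Z => ent T f).
Proof.
apply: continuous_sumf => b _ T.
by apply: continuous_comp; [exact: continuous_law|exact: continuous_xlnx].
Qed.

Definition Iform (B C : finType) (f : A -> B * C) (T : Z) : R :=
  (ent T f - ent T (fst \o f) - ent T (snd \o f)) / ln 2.

Lemma continuous_Iform (B C : finType) (f : A -> B * C) :
  continuous (Iform f).
Proof.
move=> T; apply: (@continuousM R Z); last exact: cst_continuous.
by apply: (@continuousB R R Z); [apply: (@continuousB R R Z)|];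
  exact: continuous_ent.
Qed.

Lemma IformE (B C : finType) (f : A -> B * C) (T : A -> R) :
  (forall a, 0 <= T a) -> mutual_info (law T f) = Iform f T.
Proof.
move=> T0; rewrite mutual_info_ent; last by move=> ?; exact: law_ge0.
by rewrite !ent_law.
Qed.

Lemma closed_level (F : Z -> R) (c : R) : continuous F -> closed [set T | F T = c].
Proof.
move=> cF; apply: (@preimage_closed _ _ F [set c]); last exact: closed_eq.
by move=> T _; exact: cF.
Qed.

Lemma compact_cube : compact [set T : Z | forall a, (T a : R) \in `[0%R, 1%R]].
Proof.
apply: (@tychonoff A (fun=> R) (fun=> [set` `[0%R : R, 1%R]])) => a.
exact: segment_compact.
Qed.

End compactness.

Section xi_max.
Variables (R : realType) (X Y : finType) (P : X * Y -> R).
Hypothesis hP : is_pmf P.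
Let PX x := law P fst x.

Let markovP (U : finType) (T : U * X * Y -> R) :
  law T (fun w => (w.1.2, w.2)) =1 P ->
  markov_chain T <-> forall w : U * X * Y, PX w.1.2 != 0 ->
    T w / PX w.1.2 - (law T (fun w => w.1) w.1 / PX w.1.2) *
      (P (w.1.2, w.2) / PX w.1.2) = 0.
Proof.
move=> /funext TP; rewrite /markov_chain TP.
have -> : law T (fun w => w.1.2) = PX by rewrite /PX -TP law_comp.
split=> [h [[u x] y] h0|h u x y h0]; first by apply/eqP; rewrite subr_eq0 h.
by apply/eqP; rewrite -subr_eq0 (h (u, x, y)).
Qed.

Lemma xi_compact (U : finType) (r : R) :
  compact [set T : prod_topology (fun _ : U * X * Y => R) | admissible P r T].
Proof.
set Z := prod_topology _.
have [kU|kU] := boolP (#|U| <= #|X| + 1)%N; last first.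
  rewrite (_ : [set T | _] = set0); first exact: compact0.
  by apply/seteqP; split=> // T [_ _ _ _]; rewrite (negbTE kU).
pose C1 := [set T : Z | \sum_w T w = 1].
pose C2 := \bigcap_(xy in [set: X * Y])
  [set T : Z | law T (fun w => (w.1.2, w.2)) xy = P xy].
pose C3 := \bigcap_(w in [set w : U * X * Y | PX w.1.2 != 0])
  [set T : Z | T w / PX w.1.2 - (law T (fun w => w.1) w.1 / PX w.1.2) *
      (P (w.1.2, w.2) / PX w.1.2) = 0].
pose C4 := [set T : Z | Iform (fun w => w.1) T <= r].
have -> : [set T : Z | admissible P r T] =
    [set T : Z | forall a, (T a : R) \in `[0%R, 1%R]] `&` (C1 `&` (C2 `&` (C3 `&` C4))).
  apply/seteqP; split=> T.
    case=> -[T0 T1] TP mT IT _; split=> [w|].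
      by rewrite /= in_itv/= T0 -T1 (bigD1 w)//= lerDl sumr_ge0.
    split=> //; split; first by move=> xy _; exact: TP.
    split; first by move=> w h; exact: ((markovP TP).1 mT).
    by rewrite /C4 /= -IformE.
  case=> T01 [T1 [TP [mT IT]]].
  have T0 w : 0 <= T w by have := T01 w; rewrite /= in_itv/= => /andP[].
  have {}TP : law T (fun w => (w.1.2, w.2)) =1 P by move=> xy; exact: TP.
  split=> //; first by apply/(markovP TP) => w h; exact: mT.
  by rewrite IformE.
apply: compact_closedI; first exact: compact_cube.
apply: closedI; first by apply: closed_level; apply: continuous_sumf => w _;
  exact: continuous_coordf.
apply: closedI; first by apply: closed_bigI => xy _; apply: closed_level;
  exact: continuous_law.
apply: closedI.
  apply: closed_bigI => w _; apply: closed_level => T.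
  apply: (@continuousB R R Z).
    by apply: (@continuousM R Z); [exact: continuous_coordf|exact: cst_continuous].
  apply: (@continuousM R Z); last exact: cst_continuous.
  by apply: (@continuousM R Z); [exact: continuous_law|exact: cst_continuous].
apply: (@preimage_closed _ _ _ [set t | t <= r]); last exact: closed_le.
by move=> T _; exact: continuous_Iform.
Qed.

Lemma xi_values_ord (r i : R) : xi_values P r i ->
  exists T : 'I_(#|X| + 1) * X * Y -> R,
    admissible P r T /\ i = mutual_info (law T (fun w => (w.1.1, w.2))).
Proof.
case=> U [T [[Tpmf TP mT IT kU] ->]].
have [g gI] : exists g : U -> 'I_(#|X| + 1), injective g.
  exists (fun u => widen_ord kU (enum_rank u)) => u v /(congr1 val) /= e.
  by apply: enum_rank_inj; exact: val_inj.
pose f (w : U * X * Y) := (g w.1.1, w.1.2, w.2).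
have fI : injective f by move=> [[u x] y] [[u' x'] y'] [/gI -> -> ->].
exists (law T f); split; last first.
  rewrite law_comp -(mutual_info_inj (law T (fun w => (w.1.1, w.2))) gI).
  by rewrite law_comp.
have T'P : law (law T f) (fun w => (w.1.2, w.2)) =1 P by rewrite law_comp.
split=> //; last by rewrite card_ord.
- exact: law_pmf.
- apply/(markovP T'P) => -[[j x] y] /= h0.
  have ge0 := Tpmf.1.
  have [[u ju]|jN] := pselect (exists u, g u = j); last first.
    rewrite law_comp !lawE !big_pred0 ?mul0r ?subrr//.
      by move=> [u x'] /=; apply/negP => /eqP[/esym e _]; apply: jN; exists u.1.
    by move=> [[u x'] y'] /=; apply/negP => /eqP[e _ _]; apply: jN; exists u.
  rewrite law_comp -ju (law_inj T (u, x, y) fI).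
  have -> : (fun w => w.1) \o f = (fun w : U * X => (g w.1, w.2)) \o (fun w => w.1).
    by [].
  rewrite -law_comp (law_inj _ (u, x)); first exact: ((markovP TP).1 mT (u, x, y)).
  by move=> [a b] [c d] [/gI -> ->].
- rewrite law_comp.
  by rewrite -[leLHS](mutual_info_inj (law T (fun w => w.1)) gI) law_comp in IT.
Qed.

Lemma xi_values_neq0 (r : R) : 0 <= r -> xi_values P r !=set0.
Proof.
move=> r0; pose T (w : unit * X * Y) := P (w.1.2, w.2).
have T0 w : 0 <= T w by exact: hP.1.
have TP : law T (fun w => (w.1.2, w.2)) =1 P.
  by move=> [x y]; apply: (law_inj T (tt, x, y)) => -[[[] a] b] [[[] c] d] [-> ->].
have T1 : \sum_w T w = 1.
  have := law_sum T (fun w => (w.1.2, w.2)) (fun=> 1).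
  under eq_bigr do rewrite mulr1 TP; under [RHS]eq_bigr do rewrite mulr1.
  by move=> <-; exact: hP.2.
exists (mutual_info (law T (fun w => (w.1.1, w.2)))), unit, T; split=> //.
split=> //; last by rewrite card_unit addn1.
  apply/(markovP TP) => -[[u x] y] /= h0.
  have -> : law T (fun w => w.1) (u, x) = PX x.
    rewrite /PX; have -> : P = law T (fun w => (w.1.2, w.2)) by apply/funext.
    rewrite law_comp !lawE; apply: eq_bigl => -[[[] a] b] /=; case: u.
    by rewrite xpair_eqE eqxx.
  by rewrite divff// mul1r subrr.
rewrite (_ : mutual_info _ = 0)//.
rewrite /mutual_info /divergence big1// => -[u x] _ /=.
set q := law T _.
have -> : product_law q (u, x) = q (u, x).
  rewrite /product_law /= (_ : law q fst u = 1) ?mul1r.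
    by rewrite lawE (big_pred1 (u, x))// => -[u' x'] /=; case: u u' => -[];
       rewrite xpair_eqE eqxx.
  rewrite lawE (eq_bigl xpredT); last by move=> [[] ?]; case: u.
  exact: (law_pmf (fun w => w.1) (conj T0 T1)).2.
have [->|q0] := eqVneq (q (u, x)) 0; first by rewrite mul0r.
by rewrite divff// /log2 ln1 mul0r mulr0.
Qed.

Lemma xiP (r : R) : 0 <= r ->
  xi_values P r (xi P r) /\ ubound (xi_values P r) (xi P r).
Proof.
move=> r0; have [i0 /xi_values_ord[T0 [aT0 _]]] := xi_values_neq0 r0.
have [|T /set_mem aT maxT] := compact_EVT_max _
  (@xi_compact 'I_(#|X| + 1) r)
  (@continuous_subspaceT _ _ _ _
    (@continuous_Iform R _ _ _ (fun w : 'I_(#|X| + 1) * X * Y => (w.1.1, w.2)))).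
  by exists T0.
pose m := mutual_info (law T (fun w => (w.1.1, w.2))).
have Sm : xi_values P r m by exists 'I_(#|X| + 1), T.
have ubm : ubound (xi_values P r) m.
  move=> _ /xi_values_ord[T' [aT' ->]]; rewrite /m !IformE; last 2 first.
  - by case: aT => -[].
  - by case: aT' => -[].
  by apply: maxT; apply/mem_set.
suff -> : xi P r = m by [].
apply/eqP; rewrite eq_le; apply/andP; split; first by apply: ge_sup => //; exists m.
by apply: ub_le_sup => //; exists m.
Qed.

End xi_max.

(* Main.v *)
Require Import Defs.
From mathcomp Require Import all_boot all_order all_algebra.
From mathcomp Require Import all_classical all_reals all_analysis.
From mathcomp Require Import ring lra.
Import Order.TTheory GRing.Theory Num.Theory.
Import numFieldNormedType.Exports.
Local Open Scope classical_set_scope.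
Local Open Scope ring_scope.
Set Implicit Arguments.
Unset Strict Implicit.
Unset Printing Implicit Defensive.

(** Converse.  Given an encoder f, let U consist of a uniform index i, the message
    f(X^n) and the past inputs X_1, ..., X_(i-1), and let X be the i-th input.
    Up to normalisation, I(U; X) is I(f(X^n); X^n), hence at most the rate, and
    I(U; Y) is at least I(f(X^n); Y^n), which by data processing is at least
    (1 - eps) log (1 / beta) - 1.  The bound on the alphabet of U is recovered by
    a linear programming argument: for fixed conditional laws of X given U the
    constraints are |X| + 1 linear equations in the law of U, and a basic optimal
    solution has at most |X| + 1 nonzero weights.

    Achievability.  Given V on U x X with I(U; X) strictly below the rate, use a
    covering codebook in U^n.  The encoder sends the codeword for which the
    detector is least likely to fail, and the detector accepts when the likelihood
    ratio P(y | u) / P(y) exceeds 2^(n (I(U; Y) - delta)).  This threshold bounds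
    the type II error by itself, for every codebook, while Chernoff bounds make
    the type I error exponentially small, hence eventually below eps_n. *)

(** * Negative entropy of unnormalised measures *)

Section negative_entropy.
Variable R : realType.

Lemma ln2_gt0 : 0 < ln 2 :> R.
Proof. by rewrite ln_gt0// ltr1n. Qed.

Lemma ln_ge_1BV (z : R) : 0 < z -> 1 - z^-1 <= ln z.
Proof.
move=> z0; have := @le_ln1Dx R (z^-1 - 1).
rewrite subrKC lnV ?posrE// => h.
have {h} := h _; rewrite ltrBrDl subrr invr_gt0 => /(_ z0); lra.
Qed.

(** The bound [1 - 1/z <= ln z] is applied termwise at the ratio of [a i / b i] to [A / B]; the
    corrections [a i - b i * (A / B)] sum to zero. *)
Lemma log_sum (I : Type) (r : seq I) (Q : pred I) (a b : I -> R) :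
  (forall i, 0 <= a i) -> (forall i, 0 <= b i) -> (forall i, b i = 0 -> a i = 0) ->
  (\sum_(i <- r | Q i) a i) *
    ln ((\sum_(i <- r | Q i) a i) / \sum_(i <- r | Q i) b i) <=
  \sum_(i <- r | Q i) a i * ln (a i / b i).
Proof.
move=> a0 b0 ab; set A := \sum_(i <- r | Q i) a i; set B := \sum_(i <- r | Q i) b i.
have [A0|AN0] := eqVneq A 0.
  rewrite A0 mul0r le_eqVlt; apply/orP; left; rewrite eq_sym.
  suff H s : \sum_(i <- s | Q i) a i = 0 -> \sum_(i <- s | Q i) a i * ln (a i / b i) = 0.
    by rewrite (H r).
  elim: s => [|i s IH]; first by rewrite !big_nil.
  rewrite !big_cons; case: ifP => // _ /eqP.
  rewrite paddr_eq0 ?sumr_ge0// => /andP[/eqP -> /eqP/IH ->].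
  by rewrite mul0r addr0.
have Ap : 0 < A by rewrite lt_neqAle eq_sym AN0 sumr_ge0.
have Bp : 0 < B.
  rewrite lt_neqAle sumr_ge0// andbT; apply/eqP => B0.
  move/eqP: AN0; apply; rewrite /A; move: B0; rewrite /B; elim: r {A B Ap} => [|i s IH].
    by rewrite !big_nil.
  rewrite !big_cons; case: ifP => // _ /esym/eqP.
  rewrite paddr_eq0 ?sumr_ge0// => /andP[/eqP/ab -> /eqP/esym/IH ->].
  by rewrite addr0.
have -> : A * ln (A / B) =
    \sum_(i <- r | Q i) (a i * ln (A / B) + a i - b i * (A / B)).
  rewrite sumrB big_split/= -!mulr_suml -/A -/B mulrCA divff ?mulr1 ?addrK//.
  by rewrite gt_eqF.
apply: ler_sum => i _; have [ai0|aiN0] := eqVneq (a i) 0.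
  by rewrite ai0 !mul0r add0r sub0r oppr_le0 mulr_ge0// divr_ge0// ltW.
have aip : 0 < a i by rewrite lt_neqAle eq_sym aiN0 a0.
have bip : 0 < b i.
  by rewrite lt_neqAle b0 andbT eq_sym; apply: contraNneq aiN0 => /ab ->.
have := @ln_ge_1BV ((a i / b i) / (A / B)).
rewrite ?divr_gt0// => /(_ isT); rewrite [ln (_ / (A / B))]ln_div ?posrE ?divr_gt0//.
move=> /(ler_wpM2l (ltW aip)).
have -> : a i * (1 - (a i / b i / (A / B))^-1) = a i - b i * (A / B).
  by field; rewrite ?gt_eqF ?andbT.
lra.
Qed.

(** For [k] of total mass m this is m times minus the entropy, in nats, of k / m. Homogeneity of
    degree one lets a joint law of (U, X) be a family of measures indexed by u, whose [negent] sum
    to -H(X | U). *)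
Definition negent (A : finType) (k : A -> R) : R :=
  \sum_a k a * ln (k a / \sum_b k b).

Lemma xlnx_div (x y : R) : 0 <= x -> x <= y -> x * ln (x / y) = xlnx x - x * ln y.
Proof.
move=> x0 xy; rewrite /xlnx.
have [->|xN0] := eqVneq x 0; first by rewrite !mul0r subrr.
have xp : 0 < x by rewrite lt_neqAle eq_sym xN0.
by rewrite ln_div ?posrE ?(lt_le_trans xp)// mulrBr.
Qed.

Lemma le_sum_nneg (A : finType) (k : A -> R) a :
  (forall a, 0 <= k a) -> k a <= \sum_b k b.
Proof. by move=> k0; rewrite (bigD1 a)//= lerDl sumr_ge0. Qed.

Lemma negentE (A : finType) (k : A -> R) : (forall a, 0 <= k a) ->
  negent k = \sum_a xlnx (k a) - xlnx (\sum_a k a).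
Proof.
move=> k0; rewrite /negent; under eq_bigr do rewrite xlnx_div ?le_sum_nneg//.
by rewrite sumrB -mulr_suml.
Qed.

Lemma negentZ (A : finType) (c : R) (k : A -> R) :
  negent (fun a => c * k a) = c * negent k.
Proof.
rewrite /negent mulr_sumr; apply: eq_bigr => a _; rewrite -mulr_sumr.
have [->|cN0] := eqVneq c 0; first by rewrite !mul0r.
by rewrite -mulrA -mulf_div divff// mul1r.
Qed.

(* The log-sum inequality, read off pointwise. *)
Lemma negent_mix (A I : finType) (c : I -> R) (k : I -> A -> R) :
  (forall i, 0 <= c i) -> (forall i a, 0 <= k i a) ->
  negent (fun a => \sum_i c i * k i a) <= \sum_i c i * negent (k i).
Proof.
move=> c0 k0; rewrite /negent.
under [leRHS]eq_bigr do rewrite mulr_sumr.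
rewrite [leRHS]exchange_big/=; apply: ler_sum => a _.
rewrite exchange_big/=; under [X in ln (_ / X)]eq_bigr do rewrite -mulr_sumr.
apply: le_trans (log_sum _ _ _ _ _) _ => [i|i|i|].
- exact: mulr_ge0.
- by rewrite mulr_ge0// sumr_ge0.
- move/eqP; rewrite mulf_eq0 => /orP[/eqP ->|/eqP h]; first by rewrite mul0r.
  have := le_sum_nneg a (k0 i); rewrite h => h'.
  by rewrite (_ : k i a = 0) ?mulr0//; apply/le_anti; rewrite h' k0.
apply: ler_sum => i _; have [->|cN0] := eqVneq (c i) 0; first by rewrite !mul0r.
by rewrite -mulf_div divff// mul1r mulrA.
Qed.

Definition push (A B : finType) (W : A -> B -> R) (k : A -> R) (b : B) : R :=
  \sum_a k a * W a b.

Lemma push_ge0 (A B : finType) (W : A -> B -> R) (k : A -> R) b :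
  (forall a b, 0 <= W a b) -> (forall a, 0 <= k a) -> 0 <= push W k b.
Proof. by move=> W0 k0; apply: sumr_ge0 => a _; exact: mulr_ge0. Qed.

Lemma sum_push (A B : finType) (W : A -> B -> R) (k : A -> R) :
  (forall a, is_pmf (W a)) -> \sum_b push W k b = \sum_a k a.
Proof.
move=> hW; rewrite /push exchange_big; apply: eq_bigr => a _.
by rewrite -mulr_sumr (hW a).2 mulr1.
Qed.

Lemma sum_pair (A B : finType) (F : A * B -> R) :
  \sum_w F w = \sum_a \sum_b F (a, b).
Proof. by rewrite pair_bigA/=; apply: eq_bigr => -[]. Qed.

Lemma law_fstE (A B : finType) (p : A * B -> R) a :
  law p fst a = \sum_b p (a, b).
Proof.
rewrite lawE big_mkcond sum_pair (bigD1 a)//= eqxx [X in _ + X]big1 ?addr0//.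
by move=> a' /negPf ->; rewrite big1.
Qed.

Lemma law_sndE (A B : finType) (p : A * B -> R) b :
  law p snd b = \sum_a p (a, b).
Proof.
rewrite lawE big_mkcond sum_pair; apply: eq_bigr => a _ /=.
by rewrite -big_mkcond/= big_pred1_eq.
Qed.

Lemma law_12E (A B C : finType) (p : A * B * C -> R) a b :
  law p (fun w => w.1) (a, b) = \sum_c p (a, b, c).
Proof. exact: law_fstE. Qed.

Lemma law_23E (A B C : finType) (p : A * B * C -> R) b c :
  law p (fun w => (w.1.2, w.2)) (b, c) = \sum_a p (a, b, c).
Proof.
rewrite lawE big_mkcond !sum_pair; apply: eq_bigr => a _ /=.
rewrite (bigD1 b)//= (bigD1 c)//= eqxx [X in _ + X + _]big1 ?addr0; last first.
  by move=> c' /negPf; rewrite xpair_eqE eqxx => /= ->.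
rewrite big1 ?addr0// => b' /negPf b'b.
by rewrite big1// => c' _; rewrite xpair_eqE b'b.
Qed.

Lemma law_13E (A B C : finType) (p : A * B * C -> R) a c :
  law p (fun w => (w.1.1, w.2)) (a, c) = \sum_b p (a, b, c).
Proof.
rewrite lawE big_mkcond !sum_pair (bigD1 a)//= [X in _ + X]big1 ?addr0; last first.
  move=> a' /negPf a'a; rewrite big1// => b _.
  by rewrite big1// => c' _; rewrite xpair_eqE a'a.
apply: eq_bigr => b _; rewrite (bigD1 c)//= eqxx [X in _ + X]big1 ?addr0//.
by move=> c' /negPf; rewrite xpair_eqE eqxx => /= ->.
Qed.

Lemma ent_fst (A B : finType) (p : A * B -> R) :
  ent p fst = \sum_a xlnx (\sum_b p (a, b)).
Proof. by apply: eq_bigr => a _; rewrite law_fstE. Qed.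

(** I(A; B) = H(B) - H(B | A), converted from nats to bits. *)
Lemma mutual_info_negent (A B : finType) (p : A * B -> R) :
  (forall w, 0 <= p w) ->
  mutual_info p =
    (\sum_a negent (fun b => p (a, b)) - \sum_b xlnx (law p snd b)) / ln 2.
Proof.
move=> p0; rewrite mutual_info_ent//; congr ((_ - _) / _).
rewrite ent_fst /ent sum_pair -sumrB; apply: eq_bigr => a _.
by rewrite negentE//; congr (_ - _); apply: eq_bigr => b _; rewrite (@law_inj _ _ _ _ id).
Qed.

End negative_entropy.

(** * Cardinality of the auxiliary alphabet *)

Section support_reduction.
Variables (R : realType) (U J : finType) (g : U -> J -> R).

Lemma kernel_vector (S : {set U}) : (#|J| < #|S|)%N ->
  exists d : U -> R, [/\ exists u, d u != 0, forall u, u \notin S -> d u = 0 &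
    forall j, \sum_u d u * g u j = 0].
Proof.
move=> JS; pose M : 'M[R]_(#|S|, #|J|) := \matrix_(i, j) g (enum_val i) (enum_val j).
have : kermx M != 0.
  rewrite kermx_eq0 /row_free; apply: contraTneq JS => <-.
  by rewrite -leqNgt rank_leq_col.
case/rowV0Pn => v /sub_kermxP vM vN0.
(* [law] along the injection [enum_val] extends the kernel vector by zero outside [S]. *)
exists (law (v 0) (fun i => enum_val i)); split.
- have [i vi] : exists i, v 0 i != 0.
    apply/existsP; apply: contraNT vN0; rewrite negb_exists => /forallP h.
    by apply/eqP/rowP => i; rewrite mxE; apply/eqP; rewrite -[_ == _]negbK.
  by exists (enum_val i); rewrite law_inj//; exact: enum_val_inj.
- move=> u uS; rewrite lawE big_pred0// => i; apply: contraNF uS => /eqP <-.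
  exact: enum_valP.
- move=> j; rewrite (law_sum (v 0) (fun i => enum_val i) (fun u => g u j)).
  have /matrixP/(_ 0 (enum_rank j)) := vM; rewrite !mxE => {2}<-.
  by apply: eq_bigr => i _; rewrite mxE enum_rankK.
Qed.

(* A basic optimal solution of a linear program with equality constraints
   indexed by J: moving along a kernel vector of the active columns, in the
   direction that does not decrease the objective, deactivates a column. *)
Lemma support_reduction (h : U -> R) (c : J -> R) (t : U -> R) :
  (forall u, 0 <= t u) -> (forall u, t u != 0 -> 0 < \sum_j g u j * c j) ->
  exists t' : U -> R, [/\ forall u, 0 <= t' u,
    (#|[set u | t' u != 0%R]%SET| <= #|J|)%N,
    forall j, \sum_u t' u * g u j = \sum_u t u * g u j &
    \sum_u t u * h u <= \sum_u t' u * h u].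
Proof.
have [n] := ubnP #|[set u | t u != 0%R]%SET|; elim: n t => // n IH t tn t0 tc.
have [?|JS] := leqP #|[set u | t u != 0%R]%SET| #|J|; first by exists t.
(* Of a kernel vector and its opposite, one does not decrease the objective. *)
have [d [[u1 du1] dS dg dh]] : exists d : U -> R,
    [/\ exists u, d u != 0, forall u, t u = 0 -> d u = 0,
     forall j, \sum_u d u * g u j = 0 & 0 <= \sum_u d u * h u].
  have [d [[u du] dS dg]] := kernel_vector JS.
  have {}dS v : t v = 0 -> d v = 0 by move=> tv; apply: dS; rewrite inE tv eqxx.
  have [|dh] := leP 0 (\sum_u d u * h u); first by exists d; split=> //; exists u.
  exists (fun u => - d u); split.
  - by exists u; rewrite oppr_eq0.
  - by move=> v /dS ->; rewrite oppr0.
  - by move=> j; under eq_bigr do rewrite mulNr; rewrite sumrN dg oppr0.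
  - by under eq_bigr do rewrite mulNr; rewrite sumrN oppr_ge0 ltW.
(* Pairing the relations with [c] makes [d] orthogonal to a function that is positive on the support
   of [t], so the nonzero vector [d] takes a negative value. *)
have [u0 du0] : exists u, d u < 0.
  apply/existsP; apply: contraNT du1; rewrite negb_exists => /forallP dge0.
  have {}dge0 u : 0 <= d u by rewrite leNgt.
  have dm : \sum_u d u * (\sum_j g u j * c j) = 0.
    under eq_bigr do rewrite mulr_sumr; rewrite exchange_big big1// => j _.
    by under eq_bigr do rewrite mulrA; rewrite -mulr_suml dg mul0r.
  have dm0 u : 0 <= d u * (\sum_j g u j * c j).
    have [tu|tu] := eqVneq (t u) 0; first by rewrite (dS _ tu) mul0r.
    by rewrite mulr_ge0// ltW// tc.
  move/eqP: dm; rewrite psumr_eq0// => /allP/(_ u1); rewrite mem_index_enum.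
  move=> /(_ isT); rewrite implyTb mulf_eq0 => /orP[//|/eqP m0].
  by have [/dS ->//|/tc] := eqVneq (t u1) 0; rewrite m0 ltxx.
(* Ratio test: [th] is the longest step along [d] that keeps all weights nonnegative, and it brings
   the weight of [u2] to zero. *)
have [u2 du2 umin] := @Order.TotalTheory.arg_minP _ R _ u0 (fun u => d u < 0)
  (fun u => t u / - d u) du0.
pose th := t u2 / - d u2; pose t1 u := t u + th * d u.
have thge0 : 0 <= th by rewrite divr_ge0// oppr_ge0 ltW.
have [||u|t' [t'0 t'J t'g t'h]] := IH t1.
- rewrite ltnS in tn; apply: leq_trans tn; apply: proper_card; apply/properP; split.
    apply/fintype.subsetP => u; rewrite !inE; apply: contraNN => /eqP tu.
    by rewrite /t1 tu dS// mulr0 addr0.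
  exists u2; rewrite !inE.
    by apply: contraTneq du2 => /dS ->; rewrite ltxx.
  by rewrite negbK /t1 /th invrN mulrN mulNr divfK ?subrr// lt_eqF.
- move=> u; rewrite /t1; have [du|du] := leP 0 (d u).
    by rewrite addr_ge0// mulr_ge0.
  by rewrite -[d u]opprK mulrN subr_ge0 -ler_pdivlMr ?oppr_gt0// umin.
- move=> t1u; apply: tc; apply: contraNneq t1u => tu.
  by rewrite /t1 tu dS// mulr0 addr0.
have t1E F : \sum_u t1 u * F u = \sum_u t u * F u + th * \sum_u d u * F u.
  by rewrite mulr_sumr -big_split; apply: eq_bigr => u _; rewrite mulrDl mulrA.
exists t'; split=> //.
  by move=> j; rewrite t'g t1E dg mulr0 addr0.
by apply: le_trans t'h; rewrite t1E lerDl mulr_ge0.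
Qed.

End support_reduction.

(** * Test channels on arbitrary finite alphabets *)

Section test_channels.
Variables (R : realType) (X Y : finType) (P : X * Y -> R).
Hypothesis hP : is_pmf P.

(* Off the support of the first marginal the value is irrelevant; the second
   marginal makes every row a probability. *)
Definition channel (x : X) (y : Y) : R :=
  if law P fst x == 0 then law P snd y else P (x, y) / law P fst x.

Lemma channelM x y : law P fst x * channel x y = P (x, y).
Proof.
rewrite /channel; case: eqVneq => [h|h]; last by rewrite mulrC divfK.
rewrite h mul0r; apply/le_anti; rewrite hP.1/= -h.
exact: (law_ge fst (x, y) hP.1).
Qed.

Lemma channel_pmf x : is_pmf (channel x).
Proof.
split=> [y|]; rewrite /channel; case: eqVneq => h.
- exact: law_ge0 hP.1.
- by rewrite divr_ge0 ?hP.1 ?law_ge0//; exact: hP.1.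
- exact: (law_pmf snd hP).2.
- by rewrite -mulr_suml -law_fstE divff.
Qed.

Lemma push_channel : push channel (law P fst) =1 law P snd.
Proof.
by move=> y; rewrite law_sndE; apply: eq_bigr => x _; rewrite channelM.
Qed.

(** The family [k] is a joint law of (U, X) with no bound on the alphabet of U. Reweighting by
    [support_reduction] keeps the marginal of X, which is |X| equations, and H(X | U), one more,
    without decreasing -H(Y | U). Hence I(U; X) is preserved and I(U; Y) does not drop. *)
Lemma xi_ge (U : finType) (k : U -> X -> R) (r : R) :
  0 <= r -> (forall u x, 0 <= k u x) -> (forall x, \sum_u k u x = law P fst x) ->
  (\sum_u negent (k u) - \sum_x xlnx (law P fst x)) / ln 2 <= r ->
  (\sum_u negent (push channel (k u)) - \sum_y xlnx (law P snd y)) / ln 2 <= xi P r.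
Proof.
move=> r0 k0 kP kr.
pose g u (j : X + unit) := if j is inl x then k u x else negent (k u).
(* [c] sums the marginal equations, so its pairing with [g u] is the mass of [k u]; [t0] switches
   off the measures of mass zero. *)
pose c (j : X + unit) : R := if j is inl x then 1 else 0.
pose t0 u : R := if \sum_x k u x == 0 then 0 else 1.
have [|u|t [tge0 tJ tg th]] :=
  @support_reduction R U (X + unit)%type g (fun u => negent (push channel (k u))) c t0 _ _.
- by move=> u; rewrite /t0; case: ifP.
- rewrite /t0; case: (eqVneq (\sum_x k u x) 0) => [_ /eqP//|hN _].
  rewrite big_sumType/= [X in _ + X]big1 ?addr0; last by move=> *; rewrite mulr0.
  under eq_bigr do rewrite mulr1.
  by rewrite lt_neqAle eq_sym hN sumr_ge0.
have k_eq0 u x : \sum_x k u x = 0 -> k u x = 0.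
  by move=> h; apply/le_anti; rewrite k0 -h le_sum_nneg.
have t0k u x : t0 u * k u x = k u x.
  by rewrite /t0; case: eqVneq => [/k_eq0 ->|_]; rewrite ?mulr0 ?mul1r.
have t0negent (B : finType) (W : X -> B -> R) u :
    t0 u * negent (push W (k u)) = negent (push W (k u)).
  rewrite -negentZ; congr negent; apply/funext => y.
  by rewrite /push mulr_sumr; apply: eq_bigr => x _; rewrite mulrA t0k.
have tk x : \sum_u t u * k u x = law P fst x.
  by rewrite -kP (tg (inl x)); apply: eq_bigr => u _; rewrite t0k.
have tn : \sum_u t u * negent (k u) = \sum_u negent (k u).
  rewrite (tg (inr tt)); apply: eq_bigr => u _ /=.
  by rewrite -negentZ; congr negent; apply/funext => x; rewrite t0k.
set S := [set u | t u != 0%R]%SET in tJ.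
have sumS F : \sum_(i < #|S|) t (enum_val i) * F (enum_val i) = \sum_u t u * F u.
  rewrite -(big_enum_val (fun u => t u * F u)) big_mkcond/=.
  by apply: eq_bigr => u _; rewrite inE; case: eqVneq => // ->; rewrite mul0r.
(* The new U ranges over the support of the reweighted solution, and Y is drawn from X by the
   channel, whence the Markov property. *)
pose T (w : 'I_#|S| * X * Y) :=
  t (enum_val w.1.1) * k (enum_val w.1.1) w.1.2 * channel w.1.2 w.2.
have T0 w : 0 <= T w by rewrite /T !mulr_ge0// (channel_pmf _).1.
have T12 i x : law T (fun w => w.1) (i, x) = t (enum_val i) * k (enum_val i) x.
  by rewrite law_12E /T/= -mulr_sumr (channel_pmf x).2 mulr1.
have T23 : law T (fun w => (w.1.2, w.2)) = P.
  apply/funext => -[x y]; rewrite law_23E /T/= -mulr_suml.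
  by rewrite (sumS (fun u => k u x)) tk channelM.
have T2 : law T (fun w => w.1.2) = law P fst by rewrite -T23 law_comp.
have T3 : law T (fun w => w.2) = law P snd by rewrite -T23 law_comp.
apply: (@le_trans _ _ (mutual_info (law T (fun w => (w.1.1, w.2))))).
  rewrite mutual_info_negent => [|w]; last exact: law_ge0.
  rewrite law_comp -/(law T (fun w => w.2)) [snd \o _](_ : _ = fun w => w.2)// T3.
  rewrite ler_pM2r ?invr_gt0 ?ln2_gt0 // lerD2r.
  under eq_bigr do rewrite -(t0negent _ channel).
  apply: le_trans th _; rewrite -sumS; apply: ler_sum => i _; rewrite -negentZ.
  rewrite le_eqVlt; apply/orP; left; apply/eqP; congr negent; apply/funext => y.
  by rewrite law_13E mulr_sumr; apply: eq_bigr => x _; rewrite mulrA.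
apply: (xiP hP r0).2 _ _; exists 'I_#|S|, T; split=> //; split=> //.
- split=> //; rewrite -hP.2 -T23.
  have := law_sum T (fun w => (w.1.2, w.2)) (fun=> 1).
  by under eq_bigr do rewrite mulr1; under [RHS]eq_bigr do rewrite mulr1.
- by rewrite T23.
- rewrite /markov_chain T2 T23 => i x y PX0; rewrite T12 /T/=.
  by rewrite /channel (negPf PX0); field.
- apply: le_trans kr; rewrite mutual_info_negent => [|w]; last exact: law_ge0.
  rewrite law_comp [snd \o _](_ : _ = fun w => w.1.2)// T2.
  rewrite ler_pM2r ?invr_gt0 ?ln2_gt0// lerD2r -tn -sumS.
  apply: ler_sum => i _; rewrite -negentZ.
  rewrite le_eqVlt; apply/orP; left; apply/eqP; congr negent; apply/funext => x.
  exact: T12.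
- by rewrite card_ord; rewrite card_sum card_unit in tJ.
Qed.

End test_channels.

(** * Blocks and single-letterization *)

Section blocks.
Variable R : realType.

Definition fcons (A : Type) n (a : A) (w : {ffun 'I_n -> A}) : {ffun 'I_n.+1 -> A} :=
  [ffun i => oapp w a (unlift ord0 i)].

Lemma fcons0 (A : Type) n (a : A) (w : {ffun 'I_n -> A}) : fcons a w ord0 = a.
Proof. by rewrite ffunE unlift_none. Qed.

Lemma fconsS (A : Type) n (a : A) (w : {ffun 'I_n -> A}) i :
  fcons a w (lift ord0 i) = w i.
Proof. by rewrite ffunE liftK. Qed.

Lemma sum_fcons (A : finType) n (F : {ffun 'I_n.+1 -> A} -> R) :
  \sum_w F w = \sum_a \sum_w F (fcons a w).
Proof.
rewrite pair_bigA (reindex (fun aw : A * {ffun 'I_n -> A} => fcons aw.1 aw.2))//=.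
exists (fun w : {ffun 'I_n.+1 -> A} => (w ord0, [ffun i => w (lift ord0 i)])).
  move=> [a w] _ /=; rewrite fcons0; congr (_, _).
  by apply/ffunP => i; rewrite ffunE fconsS.
move=> w _ /=; apply/ffunP => i; rewrite ffunE.
by case: unliftP => [j|] ->//=; rewrite ffunE.
Qed.

Definition block (A : Type) n (p : A -> R) (w : {ffun 'I_n -> A}) : R :=
  \prod_i p (w i).

Definition block_kernel (A B : Type) n (W : A -> B -> R)
    (w : {ffun 'I_n -> A}) (v : {ffun 'I_n -> B}) : R :=
  \prod_i W (w i) (v i).

Lemma block_ge0 (A : Type) n (p : A -> R) (w : {ffun 'I_n -> A}) :
  (forall a, 0 <= p a) -> 0 <= block p w.
Proof. by move=> p0; apply: prodr_ge0. Qed.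

Lemma block_kernel_pmf (A B : finType) n (W : A -> B -> R) (w : {ffun 'I_n -> A}) :
  (forall a, is_pmf (W a)) -> is_pmf (block_kernel W w).
Proof.
move=> hW; split=> [v|]; first by apply: prodr_ge0 => i _; exact: (hW _).1.
rewrite -(bigA_distr_bigA (fun i b => W (w i) b)) big1// => i _.
exact: (hW _).2.
Qed.

Lemma block_pmf (A : finType) n (p : A -> R) :
  is_pmf p -> is_pmf (block p : {ffun 'I_n -> A} -> R).
Proof.
move=> hp; split=> [w|]; first by apply: block_ge0; exact: hp.1.
by rewrite -(bigA_distr_bigA (fun=> p)) big1// => i _; exact: hp.2.
Qed.

Lemma block_marginal (A : finType) n (p : A -> R) (G : A -> R) (i : 'I_n) :
  is_pmf p -> \sum_(w : {ffun 'I_n -> A}) block p w * G (w i) = \sum_a p a * G a.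
Proof.
(* [G] is absorbed in the factor at [i]; every other coordinate sums to 1. *)
move=> hp; pose F j a := p a * (if j == i then G a else 1).
transitivity (\sum_(w : {ffun 'I_n -> A}) \prod_j F j (w j)).
  apply: eq_bigr => w _; rewrite big_split/=; congr (_ * _).
  by rewrite -big_mkcond/= big_pred1_eq.
rewrite -bigA_distr_bigA (bigD1 i)//= [X in _ * X]big1 ?mulr1.
  by apply: eq_bigr => a _; rewrite /F eqxx.
by move=> j /negPf ji; rewrite -[RHS]hp.2; apply: eq_bigr => a _; rewrite /F ji mulr1.
Qed.

Lemma block_gt0 (A : finType) n (p : A -> R) (w : {ffun 'I_n -> A}) :
  (forall a, 0 <= p a) -> block p w != 0 -> forall i, 0 < p (w i).
Proof. by move=> p0 /prodf_neq0 h i; rewrite lt_neqAle p0 eq_sym h. Qed.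

Lemma ln_prod (I : Type) (r : seq I) (F : I -> R) : (forall i, 0 < F i) ->
  ln (\prod_(i <- r) F i) = \sum_(i <- r) ln (F i).
Proof.
move=> F0; elim: r => [|i r IH]; first by rewrite !big_nil ln1.
by rewrite !big_cons lnM ?posrE ?prodr_gt0// IH.
Qed.

Lemma sum_xlnx_block (A : finType) n (p : A -> R) : is_pmf p ->
  \sum_(w : {ffun 'I_n -> A}) xlnx (block p w) = n%:R * \sum_a xlnx (p a).
Proof.
move=> hp; transitivity (\sum_i \sum_(w : {ffun 'I_n -> A}) block p w * ln (p (w i))).
  rewrite exchange_big; apply: eq_bigr => w _; rewrite -mulr_sumr /xlnx.
  have [->|w0] := eqVneq (block p w) 0; first by rewrite !mul0r.
  by rewrite -ln_prod// => i; apply: block_gt0 w0 _; exact: hp.1.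
under eq_bigr do rewrite (block_marginal (fun a => ln (p a)))//.
by rewrite sumr_const card_ord mulr_natl.
Qed.

Lemma push_block (A B : finType) n (p : A -> R) (W : A -> B -> R)
    (v : {ffun 'I_n -> B}) :
  push (block_kernel W) (block p) v = block (push W p) v.
Proof.
transitivity (\sum_(w : {ffun 'I_n -> A}) \prod_i (p (w i) * W (w i) (v i))).
  by apply: eq_bigr => w _; rewrite big_split.
by rewrite -(bigA_distr_bigA (fun i a => p a * W a (v i))).
Qed.

(** Chain rule for entropy: the law of the first letter, then the tails, each weighted by the mass
    of its first letter. *)
Lemma negent_fcons (A : finType) n (nu : {ffun 'I_n.+1 -> A} -> R) :
  (forall w, 0 <= nu w) ->
  negent nu = negent (fun a => \sum_w nu (fcons a w)) +
              \sum_a negent (fun w => nu (fcons a w)).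
Proof.
move=> nu0; rewrite !negentE// ?sum_fcons; last by move=> a; exact: sumr_ge0.
under [X in _ = _ + X]eq_bigr do rewrite negentE//.
by rewrite sumrB; ring.
Qed.

Variables (X Y : finType) (W : X -> Y -> R).
Hypothesis hW : forall x, is_pmf (W x).

Lemma push_block_fcons n (nu : {ffun 'I_n.+1 -> X} -> R) y v :
  push (block_kernel W) nu (fcons y v) =
  \sum_x W x y * push (block_kernel W) (fun w => nu (fcons x w)) v.
Proof.
rewrite /push sum_fcons; apply: eq_bigr => x _; rewrite mulr_sumr.
apply: eq_bigr => w _; rewrite /block_kernel big_ord_recl !fcons0 mulrCA.
by congr (_ * (_ * _)); apply: eq_bigr => i _; rewrite !fconsS.
Qed.

(* The measures are the laws of the coordinates given the past inputs, weighted
   by the past.  On the input side this is the chain rule; on the output side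
   convexity lets one condition on past inputs instead of past outputs. *)
Lemma block_decomposition n (nu : {ffun 'I_n -> X} -> R) : (forall w, 0 <= nu w) ->
  exists s : seq {ffun X -> R}, [/\ forall k, k \in s -> forall x, 0 <= k x,
    forall x, \sum_(k <- s) k x = \sum_w nu w * \sum_i (w i == x)%:R,
    \sum_(k <- s) negent k = negent nu &
    negent (push (block_kernel W) nu) <= \sum_(k <- s) negent (push W k)].
Proof.
elim: n nu => [|n IH] nu nu0.
  exists [::]; split=> //.
  - move=> x; rewrite big_nil big1// => w _.
    by rewrite big_ord0 mulr0.
  - rewrite big_nil /negent big1// => w _.
    rewrite (big_pred1 w) => [|v]; last by apply/esym/eqP/ffunP => -[].
    by have [->|?] := eqVneq (nu w) 0; rewrite ?mul0r// divff// ln1 mulr0.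
  - rewrite big_nil /negent big1// => w _.
    rewrite (big_pred1 w) => [|v]; last by apply/esym/eqP/ffunP => -[].
    have [->|?] := eqVneq (push (block_kernel W) nu w) 0; first by rewrite mul0r.
    by rewrite divff// ln1 mulr0.
have [s hs] := @fin_all_exists X (fun=> seq {ffun X -> R}) _
  (fun x => IH (fun w => nu (fcons x w)) (fun w => nu0 _)).
(* The first coordinate has an empty past and contributes one measure; the others come from the
   induction hypothesis for each first letter [x]. *)
pose k1 := [ffun x => \sum_w nu (fcons x w)].
have sumE F : \sum_(k <- k1 :: flatten [seq s x | x <- enum X]) F k =
    F k1 + \sum_x \sum_(k <- s x) F k :> R.
  by rewrite big_cons big_flatten big_map big_enum.
have k1E : (k1 : X -> R) = fun x => \sum_w nu (fcons x w).
  by apply/funext => x; rewrite ffunE.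
have pn0 m (mu : {ffun 'I_m -> X} -> R) v :
    (forall w, 0 <= mu w) -> 0 <= push (block_kernel W) mu v.
  by move=> mu0; apply: push_ge0 => // a b; exact: (block_kernel_pmf a hW).1.
exists (k1 :: flatten [seq s x | x <- enum X]); split.
- move=> k; rewrite inE => /orP[/eqP -> x|]; first by rewrite ffunE sumr_ge0.
  by case/flatten_mapP => x _ ks; have [h _ _ _] := hs x; exact: h.
- move=> x; rewrite sumE ffunE sum_fcons.
  have hx y : \sum_(k <- s y) k x = \sum_w nu (fcons y w) * \sum_i (w i == x)%:R.
    by have [_ h _ _] := hs y; exact: h.
  under [X in _ + X = _]eq_bigr do rewrite hx.
  transitivity (\sum_y \sum_w (nu (fcons y w) * (y == x)%:R +
      nu (fcons y w) * \sum_i (w i == x)%:R)); last first.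
    apply: eq_bigr => y _; apply: eq_bigr => w _.
    rewrite big_ord_recl fcons0 mulrDr; congr (_ + _ * _).
    by apply: eq_bigr => i _; rewrite fconsS.
  under [RHS]eq_bigr do rewrite big_split/=.
  rewrite big_split/=; congr (_ + _).
  rewrite (bigD1 x)//= eqxx [X in _ + X]big1 ?addr0; last first.
    by move=> y /negPf ->; rewrite big1// => w _; rewrite mulr0.
  by apply: eq_bigr => w _; rewrite mulr1.
- rewrite sumE negent_fcons// k1E; congr (_ + _).
  by apply: eq_bigr => x _; have [_ _ ->] := hs x.
- rewrite sumE negent_fcons; last by move=> w; exact: pn0.
  apply: lerD.
    rewrite k1E le_eqVlt; apply/orP; left; apply/eqP; congr negent.
    apply/funext => y; under eq_bigr do rewrite push_block_fcons.
    rewrite exchange_big; apply: eq_bigr => x _; rewrite -mulr_sumr mulrC.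
    by rewrite sum_push// => w; exact: block_kernel_pmf.
  (* Given the first output [y], the tail output is a mixture over the first input [x] with weights
     [W x y]; after [negent_mix] the sum over [y] removes these weights. *)
  apply: (@le_trans _ _ (\sum_y \sum_x W x y *
      negent (push (block_kernel W) (fun w => nu (fcons x w))))).
    apply: ler_sum => y _; rewrite (_ : (fun w => _) = fun v =>
      \sum_x W x y * push (block_kernel W) (fun w => nu (fcons x w)) v).
      by apply: negent_mix => [x|x v]; [exact: (hW x).1|exact: pn0].
    by apply/funext => v; exact: push_block_fcons.
  rewrite exchange_big; apply: ler_sum => x _; rewrite -mulr_suml (hW x).2 mul1r.
  by have [_ _ _] := hs x.
Qed.

End blocks.

(** * Converse *)

Lemma sum_delta (R : realType) (M : finType) (m0 : M) (F : M -> R) :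
  \sum_m (m0 == m)%:R * F m = F m0.
Proof.
rewrite (bigD1 m0)//= eqxx mul1r big1 ?addr0// => m /negPf.
by rewrite eq_sym => ->; rewrite mul0r.
Qed.

Section converse.
Variables (R : realType) (X Y : finType) (P : X * Y -> R).
Hypothesis hP : is_pmf P.
Variables (n : nat) (M : finType) (f : {ffun 'I_n -> X} -> M).

Let PX : X -> R := law P fst.
Let PY : Y -> R := law P snd.
Let hPX : is_pmf PX := law_pmf fst hP.
Let hPY : is_pmf PY := law_pmf snd hP.
Let W := channel P.
Let hW : forall x, is_pmf (W x) := channel_pmf hP.

(** Joint law of f(X^n) and X^n; [message_output] is that of f(X^n) and Y^n. *)
Definition message_block (m : M) (w : {ffun 'I_n -> X}) : R :=
  block PX w * (f w == m)%:R.

Definition message_output (m : M) (v : {ffun 'I_n -> Y}) : R :=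
  push (block_kernel W) (message_block m) v.

Local Notation nu := message_block.
Local Notation out := message_output.

Lemma message_block_ge0 m w : 0 <= nu m w.
Proof. by rewrite mulr_ge0// block_ge0//; exact: hPX.1. Qed.

Lemma message_output_ge0 m v : 0 <= out m v.
Proof.
by apply: push_ge0 => [a b|w]; [exact: (block_kernel_pmf a hW).1|exact: message_block_ge0].
Qed.

Lemma sum_message_output v : \sum_m out m v = block PY v.
Proof.
transitivity (push (block_kernel W) (block PX) v).
  rewrite exchange_big; apply: eq_bigr => w _; rewrite -mulr_suml.
  congr (_ * _); rewrite -[RHS](sum_delta (f w) (fun=> _)).
  by apply: eq_bigr => m _; rewrite mulrC.
rewrite push_block; apply: eq_bigr => i _; exact: push_channel.
Qed.

Lemma message_prob m : \sum_v out m v = \sum_w nu m w.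
Proof. by rewrite sum_push// => w; exact: block_kernel_pmf. Qed.

Lemma sum_message_prob : \sum_m \sum_w nu m w = 1.
Proof.
under eq_bigr do rewrite -message_prob.
rewrite exchange_big; under eq_bigr do rewrite sum_message_output.
exact: (block_pmf n hPY).2.
Qed.

(** H(X^n | f(X^n)) = H(X^n) - H(f(X^n)) because the message is a function of the input, and
    H(f(X^n)) is at most ln |M|. *)
Lemma negent_message :
  \sum_m negent (nu m) <= n%:R * \sum_x xlnx (PX x) + ln #|M|%:R.
Proof.
under eq_bigr do rewrite (negentE (message_block_ge0 _)).
rewrite sumrB; apply: lerD.
  rewrite exchange_big -sum_xlnx_block// le_eqVlt; apply/orP; left; apply/eqP.
  apply: eq_bigr => w _.
  rewrite -[RHS](sum_delta (f w) (fun=> _)); apply: eq_bigr => m _; rewrite /nu.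
  by case: (f w == m); rewrite ?mulr1 ?mul1r// mulr0 mul0r /xlnx mul0r.
(* Log-sum against the counting measure bounds the entropy of the message. *)
have := @log_sum R M (index_enum M) xpredT (fun m => \sum_w nu m w) (fun=> 1).
rewrite sum_message_prob mul1r sumr_const -[ln (1 / _)]opprK.
have M0 : (0 < #|M|)%N.
  rewrite lt0n; apply/eqP => M0; have := sum_message_prob.
  rewrite big_pred0 => [/esym/eqP|m]; first by rewrite oner_eq0.
  by have := card0_eq M0 m; rewrite inE.
rewrite div1r lnV ?posrE ?ltr0n// opprK => h.
rewrite lerNl (le_trans (h _ _ _))// => [m|m /eqP|].
- by rewrite sumr_ge0// => *; exact: message_block_ge0.
- by rewrite oner_eq0.
- by rewrite le_eqVlt; apply/orP; left; apply/eqP; apply: eq_bigr => m _; rewrite divr1.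
Qed.

(** The left side is I(f(X^n); Y^n) in nats. Decomposing the input measure of every message and
    dividing by n yields a test channel of rate at most [r], by [negent_message], to which [xi_ge]
    applies. *)
Lemma message_output_info (r : R) : (0 < n)%N -> 0 <= r ->
  ln #|M|%:R <= n%:R * (r * ln 2) ->
  \sum_m negent (out m) - \sum_(v : {ffun 'I_n -> Y}) xlnx (block PY v) <=
  n%:R * (xi P r * ln 2).
Proof.
move=> n0 r0 Mr; have nR : 0 < n%:R :> R by rewrite ltr0n.
have [s hs] := fin_all_exists
  (fun m => block_decomposition hW (@message_block_ge0 m)).
(* One index into [S] stands for message, coordinate and past; the factor 1/n below makes the
   coordinate uniform. *)
pose S := flatten [seq s m | m <- enum M].
have sumE F : \sum_(i < size S) n%:R^-1 * F (tnth (in_tuple S) i) =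
    n%:R^-1 * \sum_m \sum_(k <- s m) F k :> R.
  by rewrite -mulr_sumr -(big_tnth _ _ S xpredT F) big_flatten big_map big_enum.
pose k (i : 'I_(size S)) (x : X) : R := n%:R^-1 * tnth (in_tuple S) i x.
have k0 i x : 0 <= k i x.
  rewrite mulr_ge0 ?invr_ge0 ?(ltW nR)//; have := mem_tnth i (in_tuple S).
  by case/flatten_mapP => m _ km; have [h _ _ _] := hs m; exact: h.
have kP x : \sum_i k i x = PX x.
  rewrite (sumE (fun g => g x)).
  transitivity (n%:R^-1 * \sum_(w : {ffun 'I_n -> X}) \sum_(i < n) block PX w * (w i == x)%:R).
    congr (_ * _); rewrite (eq_bigr (fun m =>
        \sum_w nu m w * \sum_i (w i == x)%:R)); last by move=> m _; have [_ ->] := hs m.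
    rewrite exchange_big; apply: eq_bigr => w _; rewrite -mulr_suml -[RHS]mulr_sumr.
    congr (_ * _); rewrite -[RHS](sum_delta (f w) (fun=> _)).
    by apply: eq_bigr => m _; rewrite mulrC.
  rewrite exchange_big/=.
  under eq_bigr do rewrite (block_marginal (fun y => (y == x)%:R))//.
  rewrite sumr_const card_ord -[X in _ * X]mulr_natl mulKf ?gt_eqF//.
  rewrite (bigD1 x)//= eqxx mulr1 big1 ?addr0// => y /negPf ->.
  by rewrite mulr0.
have := xi_ge hP r0 k0 kP.
have -> : \sum_i negent (k i) = n%:R^-1 * \sum_m negent (nu m).
  under eq_bigr do rewrite negentZ.
  rewrite (sumE (fun g => negent g)); congr (_ * _).
  by apply: eq_bigr => m _; have [_ _ ->] := hs m.
have -> : \sum_i negent (push W (k i)) = n%:R^-1 * \sum_m \sum_(g <- s m) negent (push W g).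
  rewrite -(sumE (fun g => negent (push W g))); apply: eq_bigr => i _.
  rewrite -negentZ; congr negent; apply/funext => y.
  by rewrite /push mulr_sumr; apply: eq_bigr => x _; rewrite mulrA.
rewrite !ler_pdivrMr ?ln2_gt0// => h.
apply: (@le_trans _ _ (n%:R * (n%:R^-1 *
    (\sum_m \sum_(g <- s m) negent (push W g)) - \sum_y xlnx (PY y)))).
  rewrite mulrBr mulrA divff ?gt_eqF// mul1r sum_xlnx_block// lerD2r.
  by apply: ler_sum => m _; have [] := hs m.
rewrite ler_pM2l//; apply: h.
rewrite lerBlDr mulrC ler_pdivrMr// mulrDl addrC [X in _ <= X + _]mulrC.
by apply: le_trans negent_message _; rewrite lerD// mulrC.
Qed.

Lemma binary_negent (a a' : R) : 0 <= a -> 0 <= a' -> a + a' = 1 ->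
  - ln 2 <= xlnx a + xlnx a'.
Proof.
move=> a0 a'0 aa'; pose c (b : bool) := if b then a else a'.
have := @log_sum R bool (index_enum bool) xpredT c (fun=> 1).
rewrite !big_bool /c /= aa' mul1r !divr1 div1r lnV ?posrE ?addr_gt0// => h.
apply: h => // [[]//|i /eqP]; by rewrite oner_eq0.
Qed.

(** Data processing: I(f(X^n); Y^n) is the divergence of [message_output] from the product of its
    marginals, and log-sum over accepted and rejected pairs reduces it to a binary divergence, which
    is at least -a ln b - ln 2. *)
Lemma detection_converse (D : M -> {ffun 'I_n -> Y} -> bool) (r : R)
    (a := \sum_(w : M * {ffun 'I_n -> Y} | D w.1 w.2) out w.1 w.2)
    (b := \sum_(w : M * {ffun 'I_n -> Y} | D w.1 w.2)
            (\sum_x nu w.1 x) * block PY w.2) :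
  (0 < n)%N -> 0 <= r -> ln #|M|%:R <= n%:R * (r * ln 2) -> 0 < a ->
  0 < b /\ - (a * ln b) <= n%:R * (xi P r * ln 2) + ln 2.
Proof.
move=> n0 r0 Mr a0.
pose q (w : M * {ffun 'I_n -> Y}) : R := (\sum_x nu w.1 x) * block PY w.2.
pose o (w : M * {ffun 'I_n -> Y}) : R := out w.1 w.2.
have o0 w : 0 <= o w by exact: message_output_ge0.
have o_le1 w : o w <= \sum_x nu w.1 x.
  rewrite -message_prob; apply: (le_sum_nneg (k := out w.1)) => v.
  exact: message_output_ge0.
have o_le2 w : o w <= block PY w.2.
  rewrite -sum_message_output; apply: (le_sum_nneg (k := out^~ w.2)) => m.
  exact: message_output_ge0.
have q0 w : 0 <= q w.
  by rewrite mulr_ge0 ?(le_trans (o0 w) (o_le1 w)) ?(le_trans (o0 w) (o_le2 w)).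
have qo w : q w = 0 -> o w = 0.
  move/eqP; rewrite mulf_eq0 => /orP[] /eqP h; apply/le_anti; rewrite o0 andbT.
    by rewrite -h o_le1.
  by rewrite -h o_le2.
have := message_output_info n0 r0 Mr.
have -> : \sum_m negent (out m) - \sum_(v : {ffun 'I_n -> Y}) xlnx (block PY v) =
    \sum_w o w * ln (o w / q w).
  rewrite sum_pair /negent.
  have -> : \sum_(v : {ffun 'I_n -> Y}) xlnx (block PY v) =
      \sum_m \sum_(v : {ffun 'I_n -> Y}) out m v * ln (block PY v).
    rewrite exchange_big; apply: eq_bigr => v _.
    by rewrite -mulr_suml sum_message_output.
  rewrite -sumrB; apply: eq_bigr => m _; rewrite -sumrB; apply: eq_bigr => v _.
  rewrite message_prob /q /o /=; have [->|oN0] := eqVneq (out m v) 0.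
    by rewrite !mul0r subrr.
  have op : 0 < out m v by rewrite lt_neqAle eq_sym oN0 (o0 (m, v)).
  have p1 := lt_le_trans op (o_le1 (m, v)); have p2 := lt_le_trans op (o_le2 (m, v)).
  by rewrite -mulrBr -ln_div ?posrE ?divr_gt0//= invfM mulrA.
rewrite (bigID (fun w => D w.1 w.2))/=.
set S1 := \sum_(w | D w.1 w.2) _; set S2 := \sum_(w | ~~ D w.1 w.2) _ => hS.
have S1ge : a * ln (a / b) <= S1 by exact: log_sum.
pose a' := \sum_(w | ~~ D w.1 w.2) o w; pose b' := \sum_(w | ~~ D w.1 w.2) q w.
have S2ge : a' * ln (a' / b') <= S2 by exact: log_sum.
have a'0 : 0 <= a' by exact: sumr_ge0.
have zero (Q : pred (M * {ffun 'I_n -> Y})) :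
    0 < \sum_(w | Q w) o w -> 0 < \sum_(w | Q w) q w.
  move=> h; rewrite lt_neqAle sumr_ge0// andbT; apply: contraTneq h => /esym/eqP.
  rewrite psumr_eq0// => /allP h; rewrite big1 ?ltxx// => w Qw.
  by apply/qo/eqP; move: (h w (mem_index_enum w)); rewrite Qw.
have b0 : 0 < b by exact: zero.
have aa' : a + a' = 1.
  rewrite -[RHS]sum_message_prob; under [RHS]eq_bigr do rewrite -message_prob.
  by rewrite pair_bigA/= [RHS](bigID (fun w => D w.1 w.2)).
have bb' : b + b' = 1.
  transitivity (\sum_w q w); first by rewrite [RHS](bigID (fun w => D w.1 w.2)).
  rewrite sum_pair /q/=; under eq_bigr do rewrite -mulr_sumr (block_pmf n hPY).2 mulr1.
  exact: sum_message_prob.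
(* Since b' <= 1, dividing by it only increases the logarithm. *)
have a'ge : xlnx a' <= a' * ln (a' / b').
  rewrite /xlnx; have [->|a'N0] := eqVneq a' 0; first by rewrite !mul0r.
  have a'p : 0 < a' by rewrite lt_neqAle eq_sym a'N0.
  have b'p : 0 < b' by exact: zero.
  rewrite ler_pM2l// ler_ln ?posrE ?divr_gt0// ler_pdivlMr// -[leRHS]mulr1 ler_pM2l//.
  by rewrite -bb' lerDr ltW.
have := binary_negent (ltW a0) a'0 aa'.
have := S1ge; rewrite ln_div ?posrE// mulrBr -/(xlnx a) => {}S1ge.
split=> //; lra.
Qed.

End converse.

(** * Product laws and the converse bound on [beta] *)

Section iid_laws.
Variables (R : realType) (X Y : finType) (P : X * Y -> R).

Lemma iid_channel n (s : {ffun 'I_n -> X} * {ffun 'I_n -> Y}) : is_pmf P ->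
  iid P s = block (law P fst) s.1 * block_kernel (channel P) s.1 s.2.
Proof.
by move=> hP; rewrite /block -big_split; apply: eq_bigr => i _ /=; rewrite channelM.
Qed.

Lemma iid_product n (s : {ffun 'I_n -> X} * {ffun 'I_n -> Y}) :
  iid (product_law P) s = block (law P fst) s.1 * block (law P snd) s.2.
Proof. by rewrite /block -big_split. Qed.

Lemma product_law_pmf : is_pmf P -> is_pmf (product_law P).
Proof.
move=> hP; split=> [w|]; first by rewrite mulr_ge0// law_ge0//; exact: hP.1.
rewrite sum_pair /product_law/=.
under eq_bigr do rewrite -mulr_sumr (law_pmf snd hP).2 mulr1.
exact: (law_pmf fst hP).2.
Qed.

Lemma iid_pmf n : is_pmf P ->
  is_pmf (iid P : {ffun 'I_n -> X} * {ffun 'I_n -> Y} -> R).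
Proof.
move=> hP; split=> [s|]; first by apply: prodr_ge0 => i _; exact: hP.1.
rewrite sum_pair -(block_pmf n (law_pmf fst hP)).2; apply: eq_bigr => w _.
under eq_bigr do rewrite iid_channel//=.
by rewrite -mulr_sumr (block_kernel_pmf w (channel_pmf hP)).2 mulr1.
Qed.

End iid_laws.

Section beta_bounds.
Variables (R : realType) (X Y : finType) (P : X * Y -> R).
Hypothesis hP : is_pmf P.

Lemma typeI_accept n r (f : encoder X n r) (phi : decoder Y n r) :
  1 - typeI P f phi = \sum_(s in acceptance f phi) iid P s.
Proof.
rewrite -(iid_pmf n hP).2 (bigID (mem (acceptance f phi)))/= /typeI /prob.
by under [X in _ - X]eq_bigl do rewrite inE; rewrite addrK.
Qed.

Lemma sum_encoded (A B M : finType) (f : A -> M) (D : M -> B -> bool) (G : A -> B -> R) :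
  \sum_(w : M * B | D w.1 w.2) \sum_x G x w.2 * (f x == w.1)%:R =
  \sum_(s : A * B | D (f s.1) s.2) G s.1 s.2.
Proof.
rewrite big_mkcond [RHS]big_mkcond !sum_pair/= exchange_big [RHS]exchange_big/=.
apply: eq_bigr => b _.
transitivity (\sum_m \sum_x (if D m b then G x b else 0) * (f x == m)%:R).
  apply: eq_bigr => m _; case: ifP => // _.
  by rewrite big1// => x _; rewrite mul0r.
rewrite exchange_big; apply: eq_bigr => x _.
rewrite -[RHS](sum_delta (f x) (fun m => if D m b then G x b else 0)).
by apply: eq_bigr => m _; rewrite mulrC.
Qed.

Lemma nmsg_gt0 n (r : R) : 0 <= r -> (0 < nmsg n r)%N.
Proof.
move=> r0; rewrite /nmsg truncn_gt0 -[leLHS](powRr0 2).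
by rewrite ler_powR ?ler1n// mulr_ge0.
Qed.

Lemma beta_converse n (r e : R) : (0 < n)%N -> 0 <= r -> 0 < e < 1 ->
  0 < beta P n e r /\
  - ((1 - e) * ln (beta P n e r)) <= n%:R * (xi P r * ln 2) + ln 2.
Proof.
move=> n0 r0 /andP[e0 e1].
have [[[f phi]/= fe <-] _] := betaP P n e0 r0.
pose D m v := phi (m, v) == false.
have Mr : ln #|'I_(nmsg n r)|%:R <= n%:R * (r * ln 2).
  rewrite card_ord mulrA -ln_powR ler_ln ?posrE ?powR_gt0 ?ltr0n ?nmsg_gt0//.
  by rewrite truncn_le powR_ge0.
have := @detection_converse R X Y P hP n 'I_(nmsg n r) f D r n0 r0 Mr.
have -> : \sum_(w | D w.1 w.2) message_output P f w.1 w.2 = 1 - typeI P f phi.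
  rewrite typeI_accept.
  transitivity (\sum_(s : {ffun 'I_n -> X} * {ffun 'I_n -> Y} | D (f s.1) s.2)
      block (law P fst) s.1 * block_kernel (channel P) s.1 s.2).
    rewrite -(sum_encoded f D (fun x y =>
      block (law P fst) x * block_kernel (channel P) x y)).
    apply: eq_bigr => w _; apply: eq_bigr => x _.
    by rewrite /message_block mulrAC.
  by apply: eq_big => [s|s _]; rewrite ?inE// iid_channel.
have -> : \sum_(w : 'I_(nmsg n r) * {ffun 'I_n -> Y} | D w.1 w.2)
    (\sum_x message_block P f w.1 x) * block (law P snd) w.2 = typeII P f phi.
  transitivity (\sum_(s : {ffun 'I_n -> X} * {ffun 'I_n -> Y} | D (f s.1) s.2)
      block (law P fst) s.1 * block (law P snd) s.2).
    rewrite -(sum_encoded f D (fun x y => block (law P fst) x * block (law P snd) y)).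
    apply: eq_bigr => w _; rewrite mulr_suml; apply: eq_bigr => x _.
    by rewrite /message_block mulrAC.
  by apply: eq_big => [s|s _]; rewrite ?inE// iid_product.
have ae : 1 - e <= 1 - typeI P f phi by rewrite lerD2l lerN2.
move=> /(_ _)[|b0 h]; first by rewrite (lt_le_trans _ ae)// subr_gt0.
(* Passing from the success probability to the smaller [1 - e] requires a nonpositive logarithm,
   that is, a type II error at most 1. *)
split=> //; apply: le_trans h; rewrite lerN2; apply: ler_wnM2r => //.
rewrite ln_le0// /typeII /prob -(iid_pmf n (product_law_pmf hP)).2.
rewrite [leRHS](bigID (mem (acceptance f phi)))/= lerDl sumr_ge0// => s _.
exact: (iid_pmf n (product_law_pmf hP)).1.
Qed.

End beta_bounds.

(** * One-shot coding by covering *)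

Section covering.
Variable R : realType.

Lemma exists_le_mean (A : finType) (p : A -> R) (F : A -> R) : is_pmf p ->
  exists a, F a <= \sum_a p a * F a.
Proof.
move=> hp; set E := \sum_a _; apply/not_existsP => h.
have {}h a : 0 < F a - E by rewrite subr_gt0 ltNge; apply/negP/h.
have : \sum_a p a * (F a - E) = 0.
  by under eq_bigr do rewrite mulrBr; rewrite sumrB -mulr_suml hp.2 mul1r subrr.
move/eqP; rewrite psumr_eq0 => [/allP h0|a _]; last by rewrite mulr_ge0 ?hp.1 ?ltW.
have := hp.2; rewrite big1 => [/esym/eqP|a _]; first by rewrite oner_eq0.
have := h0 a (mem_index_enum _); rewrite implyTb mulf_eq0 => /orP[/eqP//|].
by rewrite gt_eqF.
Qed.

(* Codewords are picked one at a time so as not to exceed the average over the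
   next codeword; this replaces the random choice of a codebook. *)
Lemma greedy_cover (A B : finType) (p : A -> R) (G : A -> B -> bool) (M : nat) :
  is_pmf p -> forall w : B -> R, (forall b, 0 <= w b) ->
  exists cb : {ffun 'I_M -> A},
    \sum_b w b * \prod_m (~~ G (cb m) b)%:R <=
    \sum_b w b * (1 - \sum_a p a * (G a b)%:R) ^+ M.
Proof.
move=> hp; pose g b := 1 - \sum_a p a * (G a b)%:R.
have gE b : g b = \sum_a p a * (~~ G a b)%:R.
  rewrite /g -[X in X - _]hp.2 -sumrB; apply: eq_bigr => a _.
  by case: (G a b); rewrite ?mulr1 ?mulr0 ?subrr ?subr0.
have g0 b : 0 <= g b by rewrite gE sumr_ge0// => a _; rewrite mulr_ge0// hp.1.
elim: M => [|M IH] w w0.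
  exists (ffun0 (card_ord 0)). apply: ler_sum => b _.
  by rewrite big_ord0 expr0.
have [cb hcb] := IH (fun b => w b * g b) (fun b => mulr_ge0 (w0 b) (g0 b)).
have [a ha] := exists_le_mean
  (fun a => \sum_b w b * (~~ G a b)%:R * \prod_m (~~ G (cb m) b)%:R) hp.
exists (fcons a cb).
have -> : \sum_b w b * \prod_m (~~ G (fcons a cb m) b)%:R =
    \sum_b w b * (~~ G a b)%:R * \prod_m (~~ G (cb m) b)%:R.
  apply: eq_bigr => b _; rewrite big_ord_recl fcons0 mulrA; congr (_ * _).
  by apply: eq_bigr => m _; rewrite fconsS.
apply: le_trans ha _; under [leRHS]eq_bigr do rewrite exprS mulrA.
apply: le_trans hcb; rewrite le_eqVlt; apply/orP; left; apply/eqP.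
under eq_bigr do rewrite mulr_sumr.
rewrite exchange_big; apply: eq_bigr => b _; rewrite gE mulr_sumr mulr_suml.
by apply: eq_bigr => a' _; rewrite !mulrA; congr (_ * _ * _); rewrite mulrC.
Qed.

(** Convexity of exp between 0 and -z: both endpoints are compared with the tangent at the
    intermediate point [s]. *)
Lemma expR_chord (h z : R) : 0 <= h <= 1 -> expR (- (h * z)) <= 1 - h + h * expR (- z).
Proof.
move=> /andP[h0 h1]; set s := - (h * z); have es := expR_gt0 s.
have e1 : expR s * (1 - s) <= 1.
  rewrite -[leRHS](expRxMexpNx_1 s) ler_pM2l//; exact: expR_ge1Dx.
have e2 : expR s * (1 - z - s) <= expR (- z).
  have -> : expR (- z) = expR s * expR (- z - s) by rewrite -expRD; congr expR; ring.
  by rewrite ler_pM2l// -addrA; exact: expR_ge1Dx.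
have h1' : 0 <= 1 - h by rewrite subr_ge0.
have := lerD (ler_wpM2l h1' e1) (ler_wpM2l h0 e2).
rewrite mulr1; apply: le_trans; rewrite le_eqVlt; apply/orP; left; apply/eqP.
by rewrite /s; ring.
Qed.

Variables (A B C : finType) (V : A * B -> R) (W : B -> C -> R).
Hypotheses (hV : is_pmf V) (hW : forall b, is_pmf (W b)).

Let pA : A -> R := law V fst.
Let pB : B -> R := law V snd.

Definition joint_output (ac : A * C) : R := push W (fun b => V (ac.1, b)) ac.2.

(** A likelihood ratio test cleared of denominators. The guard excludes codewords of probability
    zero, for which the inequality would read 0 <= 0. *)
Definition threshold_accept (gamma : R) (a : A) (c : C) : bool :=
  (0 < pA a) && (gamma * (pA a * push W pB c) <= joint_output (a, c)).

(** The four error terms: a good codeword fails with probability at most [eta]; Markov's inequality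
    bounds the pairs that fail more often; some pairs have a density above [kappa]; and possibly
    none of the [M] codewords is good. *)
Lemma covering_code (M : nat) (gamma kappa eta : R) :
  (0 < M)%N -> 0 < gamma -> 0 < kappa -> 0 < eta ->
  let acc := threshold_accept gamma in
  exists (cb : {ffun 'I_M -> A}) (f : {ffun B -> 'I_M}),
  (forall m, \sum_c push W pB c * (acc (cb m) c)%:R <= gamma^-1) /\
  \sum_b pB b * (\sum_c W b c * (~~ acc (cb (f b)) c)%:R) <=
    eta + (\sum_a \sum_b \sum_c V (a, b) * W b c * (~~ acc a c)%:R) / eta
    + \sum_w V w * (kappa * (pA w.1 * pB w.2) < V w)%R%:R + expR (- (M%:R / kappa)).
Proof.
move=> M0 gamma0 kappa0 eta0 acc.
have pA0 a : 0 <= pA a by apply: law_ge0; exact: hV.1.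
have pB0 b : 0 <= pB b by apply: law_ge0; exact: hV.1.
have V0 w : 0 <= V w by exact: hV.1.
have W0 b c : 0 <= W b c by exact: (hW b).1.
pose bad a b := \sum_c W b c * (~~ acc a c)%:R.
have bad0 a b : 0 <= bad a b by apply: sumr_ge0 => c _; rewrite mulr_ge0.
have bad1 a b : bad a b <= 1.
  by rewrite -(hW b).2; apply: ler_sum => c _; rewrite ler_piMr// lern1 leq_b1.
(* Good pairs. The second condition makes their probability under the joint law at most [kappa]
   times that under an independent draw of the codeword. *)
pose G a b := (bad a b <= eta) && (V (a, b) <= kappa * (pA a * pB b)).
have [cb hcb] := greedy_cover G M (law_pmf fst hV) pB0.
have [b|f hf] := @fin_all_exists B (fun=> 'I_M)
    (fun b m => forall m', bad (cb m) b <= bad (cb m') b).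
  have [m _ hm] := @Order.TotalTheory.arg_minP _ R _ (Ordinal M0) xpredT
    (fun m => bad (cb m) b) isT.
  by exists m => m'; exact: hm.
exists cb, (finfun f); split=> [m|].
  have [hA|hA] := ltP 0 (pA (cb m)); last first.
    rewrite big1 ?invr_ge0 ?ltW// => c _.
    by rewrite /acc /threshold_accept ltNge hA mulr0.
  rewrite -(ler_pM2l gamma0) divff ?gt_eqF// -(ler_pM2l hA) mulr1.
  (* Where the test accepts, [gamma] times the product is below the joint output, whose total over
     [c] is the mass of the codeword. *)
  have pAE : pA (cb m) = \sum_c joint_output (cb m, c).
    by rewrite [RHS](sum_push (fun b => V (cb m, b)) hW) /pA law_fstE.
  rewrite [leRHS]pAE !mulr_sumr; apply: ler_sum => c _; rewrite /acc /threshold_accept hA/=.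
  have j0 : 0 <= joint_output (cb m, c) by apply: push_ge0.
  case: (leP (gamma * _) (joint_output _)) => h; last by rewrite !mulr0.
  by rewrite mulr1 mulrCA.
under eq_bigr do rewrite ffunE -/(bad _ _).
have step1 b : pB b * bad (cb (f b)) b <=
    eta * pB b + pB b * \prod_m (~~ G (cb m) b)%:R.
  rewrite [eta * _]mulrC -mulrDr ler_wpM2l//.
  have [/existsP[m Gm]|/existsPn h] := boolP [exists m, G (cb m) b].
    apply: (@le_trans _ _ eta); first by case/andP: Gm => h _; exact: le_trans (hf b m) h.
    by rewrite lerDl prodr_ge0.
  rewrite big1 => [|m _]; last by rewrite h.
  by apply: le_trans (bad1 _ _) _; rewrite lerDr ltW.
(* With [h] the conditional probability of a good pair given [b]: (1 - g)^M <= exp(-gM) <=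
   exp(-hM/kappa) <= 1 - h + h exp(-M/kappa). *)
have step2 b : pB b * (1 - \sum_a pA a * (G a b)%:R) ^+ M <=
    (\sum_a V (a, b) * (~~ G a b)%:R) + pB b * expR (- (M%:R / kappa)).
  have VE : \sum_a V (a, b) * (~~ G a b)%:R = pB b - \sum_a V (a, b) * (G a b)%:R.
    rewrite /pB law_sndE -sumrB; apply: eq_bigr => a _.
    by case: (G a b); rewrite /= ?mulr1 ?mulr0 ?subrr ?subr0.
  have [bp|bN] := ltP 0 (pB b); last first.
    have -> : pB b = 0 by apply/le_anti; rewrite bN pB0.
    by rewrite !mul0r addr0 sumr_ge0// => a _; rewrite mulr_ge0.
  set g := \sum_a _; pose h := (\sum_a V (a, b) * (G a b)%:R) / pB b.
  have h0 : 0 <= h by rewrite divr_ge0// sumr_ge0// => a _; rewrite mulr_ge0.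
  have h1 : h <= 1.
    rewrite ler_pdivrMr// mul1r -subr_ge0 -VE sumr_ge0// => a _.
    by rewrite mulr_ge0.
  have hg : h / kappa <= g.
    rewrite ler_pdivrMr// ler_pdivrMr// /g !mulr_suml; apply: ler_sum => a _.
    rewrite /G; case: andP => [[_ h']|_]; last by rewrite !mulr0 !mul0r.
    by rewrite !mulr1 mulrAC [_ * kappa]mulrC.
  have g1 : g <= 1.
    rewrite -(law_pmf fst hV).2; apply: ler_sum => a _.
    by rewrite ler_piMr// lern1 leq_b1.
  rewrite VE -[X in _ <= X - _ + _]mulr1 -[X in _ - X + _](divfK (lt0r_neq0 bp)).
  rewrite -/h [h * _]mulrC -mulrBr -mulrDr ler_pM2l//.
  apply: (@le_trans _ _ (expR (- g) ^+ M)).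
    rewrite lerXn2r ?nnegrE ?subr_ge0 ?expR_ge0//; exact: expR_ge1Dx.
  rewrite -expRM_natr; apply: (@le_trans _ _ (expR (- (h * (M%:R / kappa))))).
    rewrite ler_expR mulNr lerN2 mulrCA mulrC ler_wpM2r//.
  have hh : 0 <= h <= 1 by rewrite h0.
  apply: le_trans (expR_chord _ hh) _.
  by rewrite lerD2l ler_piMl// expR_ge0.
apply: le_trans (ler_sum _ (fun b _ => step1 b)) _.
rewrite big_split/= -mulr_sumr (law_pmf snd hV).2 mulr1 -!addrA lerD2l.
apply: le_trans hcb _; apply: le_trans (ler_sum _ (fun b _ => step2 b)) _.
rewrite big_split/= -mulr_suml (law_pmf snd hV).2 mul1r !addrA lerD2r.
rewrite exchange_big/= sum_pair mulr_suml -big_split; apply: ler_sum => a _.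
rewrite mulr_suml -big_split; apply: ler_sum => b _ /=.
have -> : \sum_c V (a, b) * W b c * (~~ acc a c)%:R = V (a, b) * bad a b.
  by rewrite /bad mulr_sumr; apply: eq_bigr => c _; rewrite mulrA.
rewrite -mulrA -mulrDr ler_wpM2l//.
have be : 0 <= bad a b / eta by rewrite divr_ge0// ltW.
(* A pair that is not good has either failure probability above [eta], so that its ratio to [eta]
   exceeds 1, or density above [kappa]. *)
rewrite /G negb_and -!ltNge; case: (ltP eta (bad a b)) => h /=.
  by rewrite -[leLHS]addr0 lerD// ler_pdivlMr// mul1r ltW.
by rewrite -[leLHS]add0r lerD.
Qed.

End covering.

(** * Exponentially small error for blocks *)

Section large_deviations.
Variable R : realType.

(** exp(x) <= 1/(1 - x), and the quadratic times 1 - x is 1 + x^2 (1 - 2x), at least 1 in this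
    range. *)
Lemma expR_le_quadratic (x : R) : x <= 2^-1 -> expR x <= 1 + x + 2 * x ^+ 2.
Proof.
move=> x2; have x1 : 0 < 1 - x by lra.
have h : (1 - x) * expR x <= 1.
  by rewrite -[leRHS](expRxMexpNx_1 x) mulrC ler_pM2l ?expR_gt0//; exact: expR_ge1Dx.
rewrite -(ler_pM2l x1); apply: le_trans h _.
have -> : (1 - x) * (1 + x + 2 * x ^+ 2) = 1 + x ^+ 2 * (1 - 2 * x) by ring.
by rewrite lerDl mulr_ge0 ?sqr_ge0//; lra.
Qed.

(** Chernoff bound: on the event, the shifted variables [z], of mean [d], have a nonpositive sum,
    and exp(-t z) has mean below 1 for small t > 0. *)
Lemma iid_chernoff (A : finType) (p : A -> R) (g : A -> R) (d : R) :
  is_pmf p -> 0 < d -> exists2 rho : R, 0 < rho < 1 &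
  forall n, \sum_(w : {ffun 'I_n -> A})
    block p w * (\sum_i g (w i) <= n%:R * (\sum_a p a * g a - d))%R%:R <= rho ^+ n.
Proof.
move=> hp d0; set mu := \sum_a _.
pose z a := g a - mu + d.
have pz : \sum_a p a * z a = d.
  rewrite /z; under eq_bigr do rewrite -addrA mulrDr.
  by rewrite big_split/= -mulr_suml hp.2 mul1r -/mu; ring.
pose K := \sum_a `|z a|.
have zK a : `|z a| <= K by apply: (le_sum_nneg (k := fun a => `|z a|)).
have dK : d <= K.
  rewrite -pz -[K]mul1r -hp.2 mulr_suml; apply: ler_sum => a _.
  rewrite ler_wpM2l ?hp.1//; exact: le_trans (ler_norm _) (zK a).
have K0 : 0 < K by exact: lt_le_trans dK.
(* This [t] minimises -t d + 2 t^2 K^2, the increment given by [expR_le_quadratic], with value -d^2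
   / (8 K^2); [d <= K] keeps t K below 1/2. *)
pose t := d / (4 * K ^+ 2).
have t0 : 0 < t by rewrite divr_gt0// mulr_gt0// exprn_gt0.
have tz a : - (t * z a) <= 2^-1.
  apply: (@le_trans _ _ (t * K)).
    rewrite -mulrN ler_pM2l//; apply: le_trans (zK a); rewrite -normrN; exact: ler_norm.
  have -> : t * K = (d / K) / 4 by rewrite /t; field; rewrite gt_eqF.
  have : d / K <= 1 by rewrite ler_pdivrMr// mul1r.
  lra.
pose rho := \sum_a p a * expR (- (t * z a)).
have rho1 : rho < 1.
  apply: (@le_lt_trans _ _ (\sum_a p a * (1 - t * z a + 2 * (t * K) ^+ 2))).
    apply: ler_sum => a _; rewrite ler_wpM2l ?hp.1//.
    apply: le_trans (expR_le_quadratic (tz a)) _; rewrite lerD2l ler_pM2l// sqrrN.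
    rewrite -[leLHS]real_normK ?num_real// lerXn2r ?nnegrE ?normr_ge0//.
      by rewrite mulr_ge0// ltW.
    by rewrite normrM gtr0_norm// ler_pM2l.
  under eq_bigr do rewrite -addrA mulrDr mulr1 mulrDr mulrN mulrCA.
  rewrite big_split/= hp.2 big_split/= sumrN -mulr_sumr pz -mulr_suml hp.2 mul1r.
  rewrite gtrDl /t.
  have -> : - (d / (4 * K ^+ 2) * d) + 2 * (d / (4 * K ^+ 2) * K) ^+ 2 =
      - (8^-1 * (d / K) ^+ 2) by field; rewrite gt_eqF.
  by rewrite oppr_lt0 mulr_gt0// exprn_gt0// divr_gt0.
have rho0 : 0 < rho.
  have [a pa] : exists a, 0 < p a.
    apply/not_existsP => h; have := hp.2; rewrite big1 => [/esym/eqP|a _].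
      by rewrite oner_eq0.
    by apply/le_anti; rewrite hp.1 leNgt andbT; apply/negP/h.
  rewrite /rho (bigD1 a)//= ltr_pwDl ?mulr_gt0 ?expR_gt0// sumr_ge0// => b _.
  by rewrite mulr_ge0 ?hp.1 ?expR_ge0.
exists rho; first by rewrite rho0.
move=> n; rewrite /rho -[in leRHS](card_ord n) -prodr_const.
rewrite (eq_bigl xpredT)// bigA_distr_bigA; apply: ler_sum => w _.
rewrite big_split/= -expR_sum ler_wpM2l//.
  by apply: prodr_ge0 => i _; exact: hp.1.
case: (leP (\sum_i g (w i)) _) => h; last exact: expR_ge0.
rewrite -[leLHS]expR0 ler_expR sumrN oppr_ge0 -mulr_sumr pmulr_rle0//.
rewrite /z; under eq_bigr do rewrite -addrA.
rewrite big_split/= sumr_const card_ord -mulr_natl.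
rewrite -subr_ge0 in h; rewrite -oppr_ge0; apply: le_trans h _.
by rewrite le_eqVlt; apply/orP; left; apply/eqP; ring.
Qed.

End large_deviations.

Section block_coding.
Variable R : realType.

Definition fzip (A B : Type) n (a : {ffun 'I_n -> A}) (b : {ffun 'I_n -> B}) :
  {ffun 'I_n -> A * B} := [ffun i => (a i, b i)].

Lemma sum_fzip (A B : finType) n (F : {ffun 'I_n -> A * B} -> R) :
  \sum_w F w = \sum_a \sum_b F (fzip a b).
Proof.
rewrite pair_bigA (reindex (fun ab : {ffun 'I_n -> A} * {ffun 'I_n -> B} =>
  fzip ab.1 ab.2))//=.
exists (fun w : {ffun 'I_n -> A * B} => ([ffun i => (w i).1], [ffun i => (w i).2])).
  by move=> [a b] _ /=; congr (_, _); apply/ffunP => i; rewrite !ffunE.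
by move=> w _; apply/ffunP => i; rewrite !ffunE /=; case: (w i).
Qed.

(** An i.i.d. sequence of pairs read as a pair of sequences, the form to which [covering_code]
    applies. *)
Definition block_pair (A B : Type) n (V : A * B -> R)
  (w : {ffun 'I_n -> A} * {ffun 'I_n -> B}) : R := block V (fzip w.1 w.2).

Lemma block_pairE (A B : Type) n (V : A * B -> R)
    (a : {ffun 'I_n -> A}) (b : {ffun 'I_n -> B}) :
  block_pair V (a, b) = \prod_i V (a i, b i).
Proof. by apply: eq_bigr => i _; rewrite ffunE. Qed.

Lemma block_pair_fst (A B : finType) n (V : A * B -> R) (a : {ffun 'I_n -> A}) :
  law (block_pair V) fst a = block (law V fst) a.
Proof.
rewrite law_fstE; under eq_bigr do rewrite block_pairE.
rewrite -(bigA_distr_bigA (fun i b => V (a i, b))); apply: eq_bigr => i _.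
by rewrite law_fstE.
Qed.

Lemma block_pair_snd (A B : finType) n (V : A * B -> R) (b : {ffun 'I_n -> B}) :
  law (block_pair V) snd b = block (law V snd) b.
Proof.
rewrite law_sndE; under eq_bigr do rewrite block_pairE.
rewrite -(bigA_distr_bigA (fun i a => V (a, b i))); apply: eq_bigr => i _.
by rewrite law_sndE.
Qed.

Lemma block_pair_pmf (A B : finType) n (V : A * B -> R) : is_pmf V ->
  is_pmf (block_pair V : {ffun 'I_n -> A} * {ffun 'I_n -> B} -> R).
Proof.
move=> hV; split=> [w|]; first by apply: block_ge0; exact: hV.1.
by rewrite sum_pair -(sum_fzip (block V)) (block_pmf n hV).2.
Qed.

Lemma joint_output_block (A B C : finType) n (V : A * B -> R) (W : B -> C -> R)
    (a : {ffun 'I_n -> A}) (c : {ffun 'I_n -> C}) :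
  joint_output (block_pair V) (block_kernel W) (a, c) =
  block_pair (joint_output V W) (a, c).
Proof.
transitivity (\sum_(b : {ffun 'I_n -> B}) \prod_i (V (a i, b i) * W (b i) (c i))).
  by apply: eq_bigr => b _; rewrite block_pairE big_split.
rewrite block_pairE.
by rewrite -(bigA_distr_bigA (fun i b => V (a i, b) * W b (c i))).
Qed.

End block_coding.

(** * Concentration of the information density *)

Section information_density.
Variables (R : realType) (A B : finType) (p : A * B -> R).
Hypothesis hp : is_pmf p.

Let dens (w : A * B) : R := ln (p w / product_law p w).

Lemma mutual_info_ln : mutual_info p * ln 2 = \sum_w p w * dens w.
Proof.
rewrite /mutual_info /divergence mulr_suml; apply: eq_bigr => w _.
by rewrite /log2 mulrA divfK// gt_eqF// ln2_gt0.
Qed.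

Lemma block_density n (w : {ffun 'I_n -> A} * {ffun 'I_n -> B}) :
  block_pair p w != 0 ->
  block_pair p w = expR (\sum_i dens (w.1 i, w.2 i)) *
    (block (law p fst) w.1 * block (law p snd) w.2).
Proof.
case: w => a b /=; rewrite block_pairE => /prodf_neq0 h.
rewrite expR_sum /block -!big_split; apply: eq_bigr => i _ /=.
have pi : 0 < p (a i, b i) by rewrite lt_neqAle eq_sym h// hp.1.
have p1 := lt_le_trans pi (law_ge fst (a i, b i) hp.1).
have p2 := lt_le_trans pi (law_ge snd (a i, b i) hp.1).
rewrite lnK ?posrE ?divr_gt0 ?mulr_gt0// divfK//.
by rewrite gt_eqF// mulr_gt0.
Qed.

Lemma product_block_gt0 n (w : {ffun 'I_n -> A} * {ffun 'I_n -> B}) :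
  block_pair p w != 0 -> 0 < block (law p fst) w.1 * block (law p snd) w.2.
Proof.
move=> h; have pw : 0 < block_pair p w.
  by rewrite lt_neqAle eq_sym h (block_pair_pmf n hp).1.
by rewrite -(pmulr_rgt0 _ (expR_gt0 (\sum_i dens (w.1 i, w.2 i)))) -block_density.
Qed.

(** On the event, the sum of the densities falls short of its mean, n I(A; B) in nats, by more than
    n d. *)
Lemma low_density (d : R) : 0 < d -> exists2 rho : R, 0 < rho < 1 &
  forall n, \sum_(w : {ffun 'I_n -> A} * {ffun 'I_n -> B}) block_pair p w *
    (block_pair p w < expR (n%:R * (mutual_info p * ln 2 - d)) *
      (block (law p fst) w.1 * block (law p snd) w.2))%R%:R <= rho ^+ n.
Proof.
move=> d0; have [rho rho01 h] := iid_chernoff dens hp d0.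
exists rho => // n; apply: le_trans (h n); rewrite sum_fzip sum_pair.
apply: ler_sum => a _; apply: ler_sum => b _; rewrite -/(block_pair p (a, b)).
have [->|h0] := eqVneq (block_pair p (a, b)) 0; first by rewrite !mul0r.
rewrite ler_wpM2l ?(block_pair_pmf n hp).1// [X in (X < _)%R]block_density//.
rewrite ltr_pM2r ?product_block_gt0// ltr_expR mutual_info_ln ler_nat.
under [X in (_ <= (X <= _)%R)%N]eq_bigr do rewrite ffunE.
by case: ltP => [/ltW ->|].
Qed.

Lemma high_density (d : R) : 0 < d -> exists2 rho : R, 0 < rho < 1 &
  forall n, \sum_(w : {ffun 'I_n -> A} * {ffun 'I_n -> B}) block_pair p w *
    (expR (n%:R * (mutual_info p * ln 2 + d)) *
      (block (law p fst) w.1 * block (law p snd) w.2) < block_pair p w)%R%:R <= rho ^+ n.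
Proof.
(* An upper tail for [dens] is a lower tail for its opposite. *)
move=> d0; have [rho rho01 h] := iid_chernoff (fun w => - dens w) hp d0.
exists rho => // n; apply: le_trans (h n); rewrite sum_fzip sum_pair.
apply: ler_sum => a _; apply: ler_sum => b _; rewrite -/(block_pair p (a, b)).
have [->|h0] := eqVneq (block_pair p (a, b)) 0; first by rewrite !mul0r.
rewrite ler_wpM2l ?(block_pair_pmf n hp).1// [X in (_ < X)%R]block_density//.
rewrite ltr_pM2r ?product_block_gt0// ltr_expR mutual_info_ln ler_nat.
have -> : \sum_w p w * - dens w = - \sum_w p w * dens w.
  by under eq_bigr do rewrite mulrN; rewrite sumrN.
rewrite sumrN -opprD mulrN lerN2.
under [X in (_ <= (_ <= X)%R)%N]eq_bigr do rewrite ffunE.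
by case: ltP => [/ltW ->|].
Qed.

End information_density.

(** * Codes with exponentially small type I error *)

Section achievability.
Variables (R : realType) (X Y U : finType) (P : X * Y -> R) (V : U * X -> R).
Hypotheses (hP : is_pmf P) (hV : is_pmf V) (VP : law V snd = law P fst).

Let W := channel P.
Let hW : forall x, is_pmf (W x) := channel_pmf hP.
Local Notation J := (joint_output V W).

Lemma joint_output_fst : law J fst = law V fst.
Proof.
apply/funext => u; rewrite !law_fstE.
exact: (sum_push (fun x => V (u, x)) hW).
Qed.

Lemma joint_output_snd : law J snd = law P snd.
Proof.
apply/funext => y; rewrite law_sndE -(push_channel hP) -VP /push exchange_big.
by apply: eq_bigr => x _; rewrite law_sndE mulr_suml.
Qed.

Lemma joint_output_pmf : is_pmf J.
Proof.
split=> [w|]; first by apply: push_ge0 => *; [exact: (hW _).1|exact: hV.1].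
rewrite sum_pair -(law_pmf fst hV).2; apply: eq_bigr => u _.
by rewrite -joint_output_fst law_fstE.
Qed.

(** Truncation loses at most a factor 2 because the integer part is at least 1. *)
Lemma nmsg_ge n (r : R) : 0 <= r -> expR (n%:R * (r * ln 2)) / 2 <= (nmsg n r)%:R.
Proof.
move=> r0; rewrite mulrA -ln_powR lnK ?posrE ?powR_gt0// ler_pdivrMr//.
have := truncnS_gt (2 `^ (n%:R * r) : R); rewrite -/(nmsg n r) -natr1.
have : 1 <= (nmsg n r)%:R :> R by rewrite ler1n nmsg_gt0.
lra.
Qed.

Lemma prob_indicator (S : finType) (p : S -> R) (E : {set S}) :
  prob p E = \sum_s p s * (s \in E)%:R.
Proof.
rewrite /prob big_mkcond; apply: eq_bigr => s _.
by case: (s \in E); rewrite ?mulr1 ?mulr0.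
Qed.

(** [covering_code] on blocks, with exponent I(U; Y) - d for [gamma] and I(U; X) + d for [kappa], in
    nats; each of the four error terms then decays exponentially. *)
Lemma exponential_code (r d : R) : 0 < d -> 0 <= r ->
  mutual_info V * ln 2 + 2 * d <= r * ln 2 ->
  exists2 rho : R, 0 < rho < 1 & forall n,
    exists (f : encoder X n r) (phi : decoder Y n r),
      typeI P f phi <= 4 * rho ^+ n /\
      typeII P f phi <= expR (- (n%:R * (mutual_info J * ln 2 - d))).
Proof.
move=> d0 r0 hr.
have [rho1 /andP[rho10 rho11] h1] := low_density joint_output_pmf d0.
have [rho2 /andP[rho20 rho21] h2] := high_density hV d0.
(* With [eta] equal to s^n the first two error terms balance: rho1^n / s^n is again s^n. *)
pose s := Num.sqrt rho1.
have s0 : 0 < s by rewrite sqrtr_gt0.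
have s1 : s < 1 by rewrite -sqrtr1 ltr_sqrt.
have s2 : rho1 = s * s by rewrite -expr2 sqr_sqrtr// ltW.
have e1 : expR (- (d / 2)) < 1 by rewrite expR_lt1 oppr_lt0 divr_gt0.
pose rho := Num.max s (Num.max rho2 (expR (- (d / 2)))).
exists rho; first by rewrite !lt_max s0 !gt_max s1 rho21 e1.
move=> n.
pose gamma := expR (n%:R * (mutual_info J * ln 2 - d)).
pose kappa := expR (n%:R * (mutual_info V * ln 2 + d)).
have [cb [f [hII hI]]] := covering_code (block_pair_pmf n hV)
  (fun b => block_kernel_pmf b hW) (nmsg_gt0 n r0)
  (expR_gt0 _ : 0 < gamma) (expR_gt0 _ : 0 < kappa) (exprn_gt0 n s0).
have lawnX : law (block_pair V) snd = block (law P fst) :> ({ffun 'I_n -> X} -> R).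
  by apply/funext => b; rewrite block_pair_snd VP.
have lawnU : law (block_pair V) fst = block (law V fst) :> ({ffun 'I_n -> U} -> R).
  by apply/funext => b; rewrite block_pair_fst.
have outn : push (block_kernel W) (block (law P fst)) = block (law P snd)
    :> ({ffun 'I_n -> Y} -> R).
  apply/funext => v; rewrite push_block; apply: eq_bigr => i _.
  exact: push_channel.
rewrite lawnX outn in hII; rewrite lawnX lawnU in hI.
pose acc := threshold_accept (block_pair V) (block_kernel W) gamma (B := {ffun 'I_n -> X}).
exists f, [ffun w => ~~ acc (cb w.1) w.2]; split; last first.
  rewrite /typeII prob_indicator sum_pair expRN -/gamma.
  rewrite -[leRHS]mul1r -[X in _ <= X * _](block_pmf n (law_pmf fst hP)).2 mulr_suml.
  apply: ler_sum => x _; apply: le_trans (ler_wpM2l _ (hII (f x))); last first.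
    by apply: block_ge0; exact: (law_pmf fst hP).1.
  rewrite mulr_sumr le_eqVlt; apply/orP; left; apply/eqP; apply: eq_bigr => y _.
  by rewrite iid_product/= inE ffunE/= eqbF_neg negbK mulrA.
rewrite /typeI prob_indicator sum_pair.
have -> : \sum_x \sum_y iid P (x, y) * ((x, y) \in ~: acceptance f
      [ffun w => ~~ acc (cb w.1) w.2])%:R =
    \sum_x block (law P fst) x *
      (\sum_y block_kernel W x y * (~~ acc (cb (f x)) y)%:R).
  apply: eq_bigr => x _; rewrite mulr_sumr; apply: eq_bigr => y _.
  by rewrite iid_channel//= !inE ffunE/= eqbF_neg negbK mulrA.
have le_rho t : 0 <= t -> t <= rho -> t ^+ n <= rho ^+ n.
  by move=> t0 tr; rewrite lerXn2r ?nnegrE// (le_trans t0).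
have s_rho : s ^+ n <= rho ^+ n by apply: le_rho; rewrite ?le_max ?lexx// ltW.
apply: le_trans hI _; rewrite -[4](_ : 1 + 1 + 1 + 1 = _); last by ring.
rewrite !mulrDl !mul1r; apply: lerD; [apply: lerD; [apply: lerD|]|].
- exact: s_rho.
- apply: (@le_trans _ _ (s ^+ n)); last exact: s_rho.
  rewrite ler_pdivrMr ?exprn_gt0// -exprMn -s2; apply: le_trans (h1 n).
  rewrite sum_pair; apply: ler_sum => a _; rewrite exchange_big; apply: ler_sum => c _.
  rewrite -mulr_suml -/(push (block_kernel W) (fun b => block_pair V (a, b)) c).
  rewrite -[push _ _ _]/(joint_output (block_pair V) (block_kernel W) (a, c)).
  rewrite joint_output_block; have [->|h0] := eqVneq (block_pair J (a, c)) 0.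
    by rewrite !mul0r.
  (* On the support of the joint law the product of marginals is positive, so a rejection comes from
     the threshold and not from a null codeword. *)
  have := product_block_gt0 joint_output_pmf h0.
  rewrite joint_output_fst joint_output_snd /= => g0.
  rewrite ler_wpM2l ?(block_pair_pmf n joint_output_pmf).1// ler_nat.
  rewrite /acc /threshold_accept lawnX outn block_pair_fst joint_output_block.
  rewrite negb_and -!ltNge; case: (ltP 0 (block (law V fst) a)) => // ale.
  by have := lt_le_trans g0 (mulr_le0_ge0 ale (block_ge0 c (law_pmf snd hP).1)); rewrite ltxx.
- have := h2 n; rewrite VP => {}h2; apply: le_trans h2 _; apply: le_rho; first exact: ltW.
  by rewrite !le_max lexx orbT.
(* The rate exceeds the exponent of [kappa] by at least d, so the number of messages over [kappa] is
   at least exp(n d) / 2, hence at least n d / 2. *)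
- apply: (@le_trans _ _ (expR (- (d / 2)) ^+ n)); last first.
    by apply: le_rho; rewrite ?expR_ge0// !le_max lexx !orbT.
  rewrite -expRM_natr ler_expR mulNr lerN2.
  have n0 : 0 <= n%:R :> R by [].
  rewrite ler_pdivlMr ?expR_gt0//.
  apply: le_trans (nmsg_ge n r0); rewrite ler_pdivlMr//.
  have -> : d / 2 * n%:R * kappa * 2 = (n%:R * d) * kappa by field.
  apply: (@le_trans _ _ (expR (n%:R * d) * kappa)).
    rewrite ler_pM2r ?expR_gt0//; apply: le_trans (expR_ge1Dx _); rewrite lerDr//.
  rewrite -expRD ler_expR -mulrDr ler_wpM2l//; lra.
Qed.

End achievability.

(** * Erasing the auxiliary variable *)

Section erasure.
Variables (R : realType) (U : finType) (lam : R).
Hypothesis lam01 : 0 <= lam <= 1.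

(** With probability [lam], independently of the rest, U is replaced by the erasure symbol
    [inr tt]. *)
Definition erase (B : finType) (p : U * B -> R) (w : (U + unit) * B) : R :=
  match w.1 with
  | inl u => (1 - lam) * p (u, w.2)
  | inr _ => lam * law p snd w.2
  end.

Lemma erase_snd (B : finType) (p : U * B -> R) : law (erase p) snd = law p snd.
Proof.
apply/funext => b; rewrite law_sndE big_sumType/= -mulr_sumr -law_sndE.
by rewrite (big_pred1 tt) => [|[]//]; rewrite /erase/= -mulrDl subrK mul1r.
Qed.

Lemma erase_pmf (B : finType) (p : U * B -> R) : is_pmf p -> is_pmf (erase p).
Proof.
case/andP: lam01 => l0 l1 hp; split=> [[[u|[]] b]|].
- by rewrite /erase/= mulr_ge0 ?subr_ge0 ?hp.1.
- by rewrite /erase/= mulr_ge0 ?law_ge0//; exact: hp.1.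
- rewrite sum_pair exchange_big -(law_pmf snd hp).2 -erase_snd.
  by apply: eq_bigr => b _; rewrite law_sndE.
Qed.

(** Given an erasure the law on B is its marginal, so only the unerased fraction carries
    information. *)
Lemma mutual_info_erase (B : finType) (p : U * B -> R) : is_pmf p ->
  mutual_info (erase p) = (1 - lam) * mutual_info p.
Proof.
move=> hp; rewrite !mutual_info_negent ?erase_snd//; last 2 first.
- exact: hp.1.
- exact: (erase_pmf hp).1.
rewrite big_sumType/= (big_pred1 tt) => [|[]//]; rewrite /erase/= negentZ.
under eq_bigr do rewrite negentZ.
rewrite -mulr_sumr [negent (law p snd)]negentE; last first.
  by move=> b; apply: law_ge0; exact: hp.1.
by rewrite (law_pmf snd hp).2 /xlnx ln1 mulr0 subr0 mulrA; congr (_ / _); ring.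
Qed.

End erasure.

Section optimal_rate.
Variables (R : realType) (X Y : finType) (P : X * Y -> R).
Hypothesis hP : is_pmf P.

Lemma markov_output (U : finType) (r : R) (T : U * X * Y -> R) : admissible P r T ->
  law T (fun w => (w.1.1, w.2)) = joint_output (law T (fun w => w.1)) (channel P).
Proof.
case=> hT /funext T23 mT _ _; apply/funext => -[u y].
rewrite law_13E; apply: eq_bigr => x _ /=.
have T2 : law T (fun w => w.1.2) = law P fst by rewrite -T23 law_comp.
(* At a null [x] the default value of [channel] is multiplied by a zero mass, and [T (u, x, y)] is
   zero as well. *)
have := mT u x y; rewrite T2 T23 /channel; case: eqVneq => [h _|h /(_ isT) e].
  have -> : T (u, x, y) = 0.
    apply/le_anti; rewrite hT.1 andbT -h -T2.
    exact: (law_ge (fun w => w.1.2) (u, x, y) hT.1).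
  have -> : law T (fun w => w.1) (u, x) = 0; last by rewrite mul0r.
  apply/le_anti; rewrite [X in _ && X]law_ge0 ?andbT; last exact: hT.1.
  have -> : 0 = law (law T (fun w => w.1)) snd x by rewrite law_comp -h -T2.
  apply: (@law_ge _ _ _ (law T (fun w => w.1)) snd (u, x)) => w.
  by apply: law_ge0; exact: hT.1.
by rewrite -[LHS](divfK h) e mulrAC divfK.
Qed.

(* Erasing an optimal auxiliary variable with a small probability makes the rate
   constraint strict, at a small cost in information. *)
Lemma xi_achievable (r e : R) : 0 < r -> 0 < e ->
  exists2 rho : R, 0 < rho < 1 & forall n,
    exists (f : encoder X n r) (phi : decoder Y n r),
      typeI P f phi <= 4 * rho ^+ n /\
      typeII P f phi <= expR (- (n%:R * (xi P r * ln 2 - e))).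
Proof.
move=> r0 e0; have [[U [T [aT xiE]]] _] := xiP hP (ltW r0).
have l2 := ln2_gt0 R.
pose x := `|xi P r| * ln 2.
have x0 : 0 <= x by rewrite mulr_ge0// ltW.
(* This caps the information lost by erasure at e / 2; adding 1 to [x] keeps the denominator
   positive. *)
pose lam := Num.min 2^-1 (e / (2 * (x + 1))).
have lam0 : 0 < lam by rewrite lt_min invr_gt0 ltr0n divr_gt0// mulr_gt0// ltr_wpDl.
have lam1 : lam <= 2^-1 by rewrite ge_min lexx.
have lam2 : lam * x <= e / 2.
  have h : lam <= e / (2 * (x + 1)) by rewrite ge_min lexx orbT.
  apply: (@le_trans _ _ (e / (2 * (x + 1)) * (x + 1))).
    by rewrite ler_pM// ?ltW// ltrDl.
  by rewrite le_eqVlt; apply/orP; left; apply/eqP; field; rewrite gt_eqF// ltr_wpDl.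
have lam01 : 0 <= lam <= 1 by apply/andP; split; lra.
(* Erasure frees [lam * (r * ln 2)] of rate, which covers 2 d; the other half of [e] pays for the
   margin d in the threshold. *)
pose d := Num.min (lam * (r * ln 2) / 2) (e / 2).
have d0 : 0 < d by rewrite lt_min !divr_gt0// mulr_gt0// mulr_gt0.
have d1 : d <= lam * (r * ln 2) / 2 by rewrite ge_min lexx.
have d2 : d <= e / 2 by rewrite ge_min lexx orbT.
case: (aT) => hT T23 _ IT _.
have hp : is_pmf (law T (fun w => w.1)) by exact: law_pmf.
have psnd : law (law T (fun w => w.1)) snd = law P fst.
  by rewrite law_comp -(funext T23) law_comp.
have hV := erase_pmf lam01 hp.
have VP : law (erase lam (law T (fun w => w.1))) snd = law P fst.
  by rewrite erase_snd.
(* Erasing U commutes with passing X through the channel. *)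
have JE : joint_output (erase lam (law T (fun w => w.1))) (channel P) =
    erase lam (law T (fun w => (w.1.1, w.2))).
  apply/funext => -[[u|u] y]; rewrite /joint_output /push /erase/=.
    under eq_bigr do rewrite -mulrA.
    by rewrite -mulr_sumr (markov_output aT).
  under eq_bigr do rewrite -mulrA.
  rewrite -mulr_sumr psnd; congr (_ * _).
  have -> : law (law T (fun w => (w.1.1, w.2))) snd = law P snd.
    by rewrite law_comp -(funext T23) law_comp.
  exact: push_channel.
have hr : mutual_info (erase lam (law T (fun w => w.1))) * ln 2 + 2 * d <= r * ln 2.
  rewrite mutual_info_erase//.
  have : (1 - lam) * mutual_info (law T (fun w => w.1)) * ln 2 <= (1 - lam) * r * ln 2.
    by rewrite ler_pM2r// ler_pM2l//; lra.
  lra.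
have [rho rho01 h] := exponential_code hP hV VP d0 (ltW r0) hr.
exists rho => // n; have [f [phi [hI hII]]] := h n.
exists f, phi; split=> //; apply: le_trans hII _.
rewrite ler_expR lerN2 ler_wpM2l// JE (mutual_info_erase lam01); last exact: law_pmf.
rewrite -xiE.
have : lam * (xi P r * ln 2) <= lam * x.
  by rewrite ler_pM2l// ler_pM2r// ler_norm.
lra.
Qed.

End optimal_rate.

(** * The limit of the type II exponent *)

Theorem theorem1 (R : realType) (X Y : finType) (P : X * Y -> R)
    (hP : is_pmf P) (hI : 0 < mutual_info P)
    (rate : R) (hrate : 0 < rate)
    (eps : nat -> R)
    (heps01 : forall n, (0 < n)%N -> 0 < eps n < 1)
    (heps0 : eps n @[n --> \oo] --> 0)
    (hepsexp : forall r : R, 0 < r ->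
       (fun n : nat => 1 / eps n) =o_\oo (fun n : nat => expR (r * n%:R))) :
  - (1 / n%:R) * log2 (beta P n (eps n) rate) @[n --> \oo] --> xi P rate.
Proof.
have l2 := ln2_gt0 R.
apply/cvgrPdist_le => e e0.
have [rho /andP[rho0 rho1] code] := xi_achievable hP hrate (mulr_gt0 e0 l2).
(* A positive bound on xi + e, used to make eps_n (xi + e) at most e / 2. *)
pose K := `|xi P rate + e| + 1.
have K0 : 0 < K by rewrite ltr_wpDl.
have lnrho : 0 < - ln rho by rewrite oppr_gt0 ln_lt0// rho0.
(* At r = -ln rho the growth hypothesis gives 1 / eps_n <= rho^(-n) / 4 eventually, so the code's
   type I error, at most 4 rho^n, is allowed. *)
have /eqoP/(_ _ (divr_gt0 ltr01 (ltr0n R 4))) o := hepsexp _ lnrho.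
near=> n.
have n0 : (0 < n)%N by near: n; exact: nbhs_infty_gt.
have nR : 0 < n%:R :> R by rewrite ltr0n.
have n2 : 2 / e < n%:R by near: n; exact: nbhs_infty_gtr.
have epsK : eps n < e / 2 / K.
  by near: n; apply: (cvgr_lt _ heps0); rewrite !divr_gt0.
have /andP[eps0 eps1] := heps01 n n0.
have eps4 : 4 * rho ^+ n <= eps n.
  have : `|1 / eps n| <= 1 / 4 * `|expR ((- ln rho) * n%:R)| by near: n.
  rewrite (ger0_norm (expR_ge0 _)) ger0_norm ?divr_ge0 ?(ltW eps0)//.
  rewrite expRM_natr expRN lnK//.
  by rewrite exprVn !div1r -invfM lef_pV2 ?posrE ?mulr_gt0 ?exprn_gt0.
have [b0 conv] := beta_converse hP n0 (ltW hrate) (heps01 n n0).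
have [_ bmin] := betaP P n eps0 (ltW hrate).
have [f [phi [hI1 hII]]] := code n.
have ble : beta P n (eps n) rate <= expR (- (n%:R * (xi P rate * ln 2 - e * ln 2))).
  by apply: le_trans hII; apply: bmin; exists (f, phi) => //=; exact: le_trans eps4.
set b := beta P n (eps n) rate in b0 conv ble *.
pose u := - (1 / n%:R) * log2 b; rewrite -/u.
have uE : - ln b = n%:R * (u * ln 2) by rewrite /u /log2; field; rewrite !gt_eqF.
clearbody u.
have lower : xi P rate - e <= u.
  have : ln b <= - (n%:R * (xi P rate * ln 2 - e * ln 2)).
    by rewrite -[leRHS]expRK ler_ln ?posrE ?expR_gt0.
  by rewrite lerNr uE ler_pM2l// -mulrBl ler_pM2r.
have upper : u <= xi P rate + e.
  have h1 : (1 - eps n) * (n%:R * u) <= n%:R * xi P rate + 1.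
    have : (1 - eps n) * (n%:R * (u * ln 2)) <= n%:R * (xi P rate * ln 2) + ln 2.
      by rewrite -uE mulrN.
    by move=> h; rewrite -(ler_pM2r l2); lra.
  (* If u > xi + e, the converse gives n e <= n eps_n (xi + e) + 1 <= n e / 2 + 1, against n e >
     2. *)
  rewrite leNgt; apply/negP => h.
  have h2 : eps n * (xi P rate + e) <= e / 2.
    apply: (@le_trans _ _ (eps n * K)).
      by rewrite ler_pM2l// (le_trans (ler_norm _))// lerDl.
    by rewrite -ler_pdivlMr// ltW.
  have h3 : (1 - eps n) * (n%:R * (xi P rate + e)) <= (1 - eps n) * (n%:R * u).
    by rewrite ler_wpM2l ?subr_ge0 ?(ltW eps1)// ler_pM2l// ltW.
  have h4 : n%:R * (eps n * (xi P rate + e)) <= n%:R * (e / 2) by rewrite ler_pM2l.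
  have h5 : 2 < n%:R * e by rewrite -ltr_pdivrMr.
  lra.
by rewrite ler_distlC; apply/andP; split; lra.
Unshelve. all: by end_near. Qed.
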